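(* Let $G$ be a graph. The following are equivalent: (a) $\Omega(G)$ is Rothberger. (b) $\Omega(G)$ is Lindelöf and does not contain a topological copy of the Cantor space. (c) $\Omega(G)$ is Lindelöf and scattered. (d) $\Omega(G)$ is Lindelöf and $G$ contains no end-faithful subgraph which is a subdivision of the binary tree. (e) For every $\subseteq$-increasing sequence $(F_n:n\in\omega)$ of finite subsets of $V(G)$ there is a sequence $(C_n:n\in\omega)$, where each $C_n$ is a connected component of $G\setminus F_n$, such that every ray of $G$ has a tail in $C_n$ for some $n\in\omega$.
   Context: A graph is a pair $G=(V(G),E(G))$ with $V(G)$ an arbitrary set and $E(G)\subseteq [V(G)]^2$ (two-element subsets). A ray in $G$ is an injective sequence of vertices $(v_0,v_1,\dots)$ with $\{v_i,v_{i+1}\}\in E(G)$ for all $i$; a tail of it is $(v_n,v_{n+1},\dots)$ for some $n$. For finite $F\subseteq V(G)$, $G\setminus F$ is the subgraph induced on $V(G)\setminus F$. A graph is connected if every pair of distinct vertices is joined by a path (so the empty graph counts as connected); a connected component is a maximal connected subgraph. Two rays of $G$ are equivalent if for every finite $F\subseteq V(G)$ they have tails lying in the same connected component of $G\setminus F$. An end is an equivalence class of rays, and $\Omega(G)$ is the set of ends. For an end $\epsilon$ and finite $F\subseteq V(G)$, $G(\epsilon,F)$ is the unique connected component of $G\setminus F$ containing a tail of every ray of $\epsilon$, and $\Omega(\epsilon,F)$ is the set of all ends having a ray contained in $G(\epsilon,F)$. A set $U\subseteq\Omega(G)$ is open if for every $\epsilon\in U$ there is a finite $F\subseteq V(G)$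 with $\Omega(\epsilon,F)\subseteq U$; this topologizes $\Omega(G)$, the end space of $G$. A subgraph $H$ of $G$ is end-faithful if two rays of $H$ are equivalent in $H$ if, and only if, they are equivalent in $G$. The binary tree is the graph on $2^{<\omega}$ (finite $0$-$1$ sequences) in which each $s$ is adjacent to its one-term extensions $s^\frown 0$ and $s^\frown 1$. A graph is a subdivision of a graph $G'$ if it is obtained from $G'$ by replacing edges by internally vertex-disjoint paths. ''$\subseteq$-increasing'' means $F_n\subseteq F_{n+1}$ for all $n$ (not necessarily strictly). A space $X$ is Rothberger if for every sequence $(\mathcal U_n:n\in\omega)$ of open covers of $X$ there are $U_n\in\mathcal U_n$ with $X=\bigcup_{n\in\omega}U_n$ (open covers are understood to be nonempty families, so that the empty space is Rothberger). $X$ is Lindelöf if every open cover has a countable subcover; $X$ is scattered if every nonempty subset has an isolated point. The Cantor space is $2^\omega$. *)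

(* Defs.v *)
From HB Require Import structures.
From mathcomp Require Import all_boot.
From mathcomp Require Import all_classical.
From mathcomp Require Import topology cantor.

Set Implicit Arguments.
Unset Strict Implicit.
Unset Printing Implicit Defensive.

Local Open Scope classical_set_scope.

(* A graph lives in an ambient type [V] and carries its own vertex set, so that
   subgraphs, components and [G \ F] are again terms of type [graph V]. *)
Record graph (V : Type) := Graph {
  gverts : set V;
  gadj : V -> V -> Prop;
  gadj_sym : forall x y, gadj x y -> gadj y x;
  gadj_irr : forall x, ~ gadj x x;
  gadj_verts : forall x y, gadj x y -> gverts x }.

HB.instance Definition _ (V : Type) := gen_eqMixin (graph V).
HB.instance Definition _ (V : Type) := gen_choiceMixin (graph V).

Section Graphs.
Context {V : Type}.
Implicit Types (G H C : graph V) (F A : set V) (r s : nat -> V) (x y z : V).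

Definition subgraph H G :=
  gverts H `<=` gverts G /\ (forall x y, gadj H x y -> gadj G x y).

Program Definition induced G A : graph V :=
  {| gverts := gverts G `&` A;
     gadj := fun x y => [/\ gadj G x y, A x & A y] |}.
Next Obligation. by move=> G A x y [xy Ax Ay]; split=> //; exact: gadj_sym. Qed.
Next Obligation. by move=> G A x [xx _ _]; exact: gadj_irr xx. Qed.
Next Obligation. by move=> G A x y [xy Ax _]; split=> //; exact: gadj_verts xy. Qed.

Definition gminus G F : graph V := induced G (~` F).

Definition finite_verts G F := finite_set F /\ F `<=` gverts G.

(* [p 0, ..., p n] is a path of length [n]; the values of [p] beyond [n] are
   irrelevant. *)
Definition gpath G (p : nat -> V) (n : nat) x y :=
  [/\ p 0 = x, p n = y,
      forall i j, i <= n -> j <= n -> p i = p j -> i = j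
    & forall i, i < n -> gadj G (p i) (p i.+1)].

Definition gconnected G :=
  forall x y, gverts G x -> gverts G y -> x <> y ->
    exists (n : nat) (p : nat -> V), gpath G p n x y.

(* The empty graph is a component of the empty graph, and of no other graph. *)
Definition component G C :=
  [/\ subgraph C G, gconnected C
    & forall H, subgraph H G -> gconnected H -> subgraph C H -> H = C].

Definition is_ray G r := injective r /\ forall i, gadj G (r i) (r i.+1).

Definition tail n r : nat -> V := fun i => r (n + i).

Definition has_tail_in r C := exists n, is_ray C (tail n r).

Definition ray_equiv G r s :=
  forall F, finite_verts G F ->
    exists C, [/\ component (gminus G F) C, has_tail_in r C & has_tail_in s C].

Definition end_faithful H G :=
  subgraph H G /\
  forall r s, is_ray H r -> is_ray H s -> (ray_equiv H r s <-> ray_equiv G r s).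

Definition is_end G (e : set (nat -> V)) :=
  exists2 r, is_ray G r & e = [set s | is_ray G s /\ ray_equiv G r s].

Definition end_space G := {e : set (nat -> V) | is_end G e}.

(* By [end_componentP] and [end_component_uniq], for finite [F] this is the
   unique component of [G \ F] containing a tail of every ray of [e]; the
   default value [G] of [xget] is then never used. *)
Definition end_component G (e : end_space G) F : graph V :=
  xget G [set C | component (gminus G F) C /\
                  forall r, sval e r -> has_tail_in r C].

Definition end_nbhd G (e : end_space G) F : set (end_space G) :=
  [set e' | exists2 r, sval e' r & is_ray (end_component e F) r].

Definition end_open G (U : set (end_space G)) :=
  forall e, U e -> exists2 F, finite_verts G F & end_nbhd e F `<=` U.

Lemma graph_eq G H : subgraph G H -> subgraph H G -> G = H.
Proof.
case: G H => [v a s i w] [v' a' s' i' w'] [/= vv' aa'] [/= v'v a'a].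
have ev : v = v' by apply/seteqP.
have ea : a = a'.
  by apply/funext => x; apply/funext => y; apply/propext; split=> [/aa'|/a'a].
subst v' a'; f_equal; exact: Prop_irrelevance.
Qed.

Lemma subgraph_refl G : subgraph G G.
Proof. by split. Qed.

Lemma subgraph_trans H G C : subgraph G H -> subgraph H C -> subgraph G C.
Proof.
by move=> [a b] [c d]; split=> [x /a/c|x y /b/d].
Qed.

Lemma gpath_sub G H p n x y : subgraph G H -> gpath G p n x y -> gpath H p n x y.
Proof. by move=> [_ GH] [p0 pn pi pa]; split=> // i /pa/GH. Qed.

Lemma is_ray_sub G H r : subgraph G H -> is_ray G r -> is_ray H r.
Proof. by move=> [_ GH] [ri ra]; split=> // i; apply/GH/ra. Qed.

Lemma is_ray_verts G r i : is_ray G r -> gverts G (r i).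
Proof. by move=> [_ ra]; apply: gadj_verts (ra i). Qed.

Lemma is_ray_tail G r n : is_ray G r -> is_ray G (tail n r).
Proof.
move=> [ri ra]; split=> [i j /ri/addnI //|i]; rewrite /tail addnS; exact: ra.
Qed.

Lemma tail_tail r m n : tail m (tail n r) = tail (n + m) r.
Proof. by apply/funext => i; rewrite /tail addnA. Qed.

Lemma gpath_refl G x : gpath G (fun=> x) 0 x x.
Proof. by split=> // i j; rewrite !leqn0 => /eqP -> /eqP ->. Qed.

Lemma gpath_drop G p n x y k : k <= n -> gpath G p n x y ->
  gpath G (fun i => p (k + i)) (n - k) (p k) y.
Proof.
move=> kn [p0 pn pi pa]; split; rewrite ?addn0 ?subnKC//.
- move=> i j ik jk /pi; rewrite -{1 2}(subnKC kn) !leq_add2l.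
  by move=> /(_ ik jk)/addnI.
- by move=> i ik; rewrite addnS; apply: pa; rewrite -ltn_subRL.
Qed.

Lemma gpath_take G p n x y k : k <= n -> gpath G p n x y ->
  gpath G p k x (p k).
Proof.
move=> kn [p0 pn pi pa]; split=> // [i j ik jk|i ik].
  by apply: pi; [exact: leq_trans ik kn|exact: leq_trans jk kn].
by apply: pa; exact: leq_trans ik kn.
Qed.

Lemma gpath_rev G p n x y : gpath G p n x y ->
  gpath G (fun i => p (n - i)) n y x.
Proof.
move=> [p0 pn pi pa]; split; rewrite ?subn0 ?subnn //.
- move=> i j i_n j_n /pi; rewrite !leq_subr => /(_ isT isT) e.
  by rewrite -(subKn i_n) e subKn.
- move=> i i_n; apply: gadj_sym.
  have -> : n - i = (n - i.+1).+1 by rewrite -subSn// subSS.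
  by apply: pa; rewrite -subSn// subSS leq_subr.
Qed.

Lemma gpath_cons G p n x y z : gadj G x y -> gpath G p n y z ->
  exists m q, gpath G q m x z.
Proof.
move=> xy pyz; have [[k kn pkx]|np] := pselect (exists2 k, k <= n & p k = x).
  by exists (n - k), (fun i => p (k + i)); rewrite -pkx; exact: gpath_drop pyz.
have [p0 pn pi pa] := pyz.
exists n.+1, (fun i => if i is j.+1 then p j else x); split=> //.
- move=> [|i] [|j] //= ik jk; first by move=> e; case: np; exists j.
    by move=> e; case: np; exists i.
  by move/pi => ->.
- by move=> [|i] ik /=; [rewrite p0|exact: pa].
Qed.

Lemma gpath_trans G p n q m x y z : gpath G p n x y -> gpath G q m y z ->
  exists k t, gpath G t k x z.
Proof.
elim: n p x => [|n IH] p x pxy qyz.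
  by case: pxy => <- -> _ _; exists m, q.
have := gpath_drop (isT : 1 <= n.+1) pxy; rewrite subSS subn0.
move=> /IH /(_ qyz) [k [t tz]]; case: pxy => p0 _ _ /(_ 0 isT).
by rewrite p0 => /gpath_cons; apply; exact: tz.
Qed.

Program Definition gunion G H : graph V :=
  {| gverts := gverts G `|` gverts H;
     gadj := fun x y => gadj G x y \/ gadj H x y |}.
Next Obligation. by move=> G H x y [] xy; [left|right]; exact: gadj_sym. Qed.
Next Obligation. by move=> G H x [] xx; exact: gadj_irr xx. Qed.
Next Obligation.
by move=> G H x y [] xy; [left|right]; exact: gadj_verts xy.
Qed.

Lemma gconnected_gunion G H x : gverts G x -> gverts H x ->
  gconnected G -> gconnected H -> gconnected (gunion G H).
Proof.
move=> Gx Hx cG cH.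
have sG : subgraph G (gunion G H) by split=> *; left.
have sH : subgraph H (gunion G H) by split=> *; right.
have join a b : gverts (gunion G H) a -> gverts (gunion G H) b ->
    a = x \/ b = x -> exists n p, gpath (gunion G H) p n a b.
  move=> Ua Ub abx; have [->|ab] := pselect (a = b).
    by exists 0, (fun=> b); exact: gpath_refl.
  case: abx => ?; subst.
    by case: Ub => [/(cG _ _ Gx)|/(cH _ _ Hx)] /(_ ab) [n [p /gpath_sub pp]];
      exists n, p; exact: pp.
  by case: Ua => [/cG/(_ Gx)|/cH/(_ Hx)] /(_ ab) [n [p /gpath_sub pp]];
      exists n, p; exact: pp.
move=> a b Ua Ub _.
have Ux : gverts (gunion G H) x by left.
have [n [p pax]] := join a x Ua Ux (or_intror erefl).
have [m [q qxb]] := join x b Ux Ub (or_introl erefl).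
exact: gpath_trans pax qxb.
Qed.

Lemma component_sub G C H x : component G C -> subgraph H G -> gconnected H ->
  gverts C x -> gverts H x -> subgraph H C.
Proof.
move=> [CG cC maxC] HG cH Cx Hx.
have <- : gunion C H = C.
  apply: maxC; last by split=> *; left.
    split=> [y [/CG.1|/HG.1]//|y z [/CG.2|/HG.2]//].
  exact: gconnected_gunion Cx Hx cC cH.
by split=> *; right.
Qed.

Lemma component_eq G C C' x : component G C -> component G C' ->
  gverts C x -> gverts C' x -> C = C'.
Proof.
move=> hC hC' Cx C'x; have [CG cC _] := hC; have [C'G cC' _] := hC'.
by apply: graph_eq; [exact: component_sub hC' CG cC C'x Cx
                    |exact: component_sub hC C'G cC' Cx C'x].
Qed.

Lemma induced_sub G A : subgraph (induced G A) G.
Proof. by split=> [x []|x y []]. Qed.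

Lemma component_exists G x : gverts G x -> exists A,
  component G (induced G A) /\ A = [set y | exists n p, gpath G p n x y].
Proof.
move=> Gx; set A := [set y | _]; exists A; split=> //.
have Ax : A x by exists 0, (fun=> x); exact: gpath_refl.
split; first exact: induced_sub.
  have xy y : A y -> exists n p, gpath (induced G A) p n x y.
    move=> [n [p pxy]]; exists n, p; have [p0 pn pi pa] := pxy; split=> // i i_n.
    split; first exact: pa.
      by exists i, p; apply: gpath_take pxy; exact: ltnW.
    by exists i.+1, p; exact: gpath_take pxy.
  move=> y z [_ Ay] [_ Az] _.
  have [n [p /gpath_rev pyx]] := xy _ Ay; have [m [q qxz]] := xy _ Az.
  exact: gpath_trans pyx qxz.
move=> H HG cH AH; apply: graph_eq => //.
have HA y : gverts H y -> A y.
  move=> Hy; have [<-//|xy] := pselect (x = y).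
  have Hx : gverts H x by apply: AH.1.
  by have [n [p /(gpath_sub HG) pp]] := cH _ _ Hx Hy xy; exists n, p.
split=> [y Hy|y z Hyz]; first by split; [exact: HG.1|exact: HA].
split; first exact: HG.2.
  by apply: HA; exact: gadj_verts Hyz.
by apply: HA; exact: gadj_verts (gadj_sym Hyz).
Qed.

Lemma ray_component G r : is_ray G r -> exists2 C, component G C & is_ray C r.
Proof.
move=> hr; have [A [cA eA]] := component_exists (is_ray_verts 0 hr).
exists (induced G A) => //; have [ri ra] := hr; split=> // i.
have rA k : A (r k).
  rewrite eA /=; exists k, r; by split=> // a b _ _ /ri.
by split.
Qed.

Lemma ray_tail_minus G F r : finite_set F -> is_ray G r ->
  exists n, is_ray (gminus G F) (tail n r).
Proof.
move=> finF [ri ra].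
have [N hN] : exists N, forall i, (r @^-1` F) i -> i < N.
  have : finite_set (r @^-1` F) by apply: finite_preimage => // i j _ _; exact: ri.
  move=> /finite_seqP[s es]; exists (\max_(i <- s) i).+1 => i.
  by rewrite es /= => si; rewrite ltnS; exact: leq_bigmax_seq.
have nF i : N <= i -> ~ F (r i) by move=> Ni /hN; rewrite ltnNge Ni.
exists N; split=> [i j /ri/addnI//|i]; rewrite /tail addnS; split.
- exact: ra.
- by apply: nF; rewrite leq_addr.
- by apply: nF; rewrite -addnS leq_addr.
Qed.

Lemma has_tail_in_common G C C' r : component G C -> component G C' ->
  has_tail_in r C -> has_tail_in r C' -> C = C'.
Proof.
move=> hC hC' [m rm] [n rn].
apply: (component_eq (x := r (m + n)) hC hC'); first exact: is_ray_verts rm.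
by rewrite addnC; exact: is_ray_verts rn.
Qed.

Lemma ray_equiv_refl G r : is_ray G r -> ray_equiv G r r.
Proof.
move=> hr F [finF _]; have [n hn] := ray_tail_minus finF hr.
by have [C hC rC] := ray_component hn; exists C; split=> //; exists n.
Qed.

Lemma ray_equiv_sym G r s : ray_equiv G r s -> ray_equiv G s r.
Proof. by move=> rs F /rs[C [? ? ?]]; exists C. Qed.

Lemma ray_equiv_trans G r s t :
  ray_equiv G r s -> ray_equiv G s t -> ray_equiv G r t.
Proof.
move=> rs st F hF; have [C [hC rC sC]] := rs _ hF.
have [C' [hC' sC' tC']] := st _ hF; exists C; split=> //.
by rewrite (has_tail_in_common hC hC' sC sC').
Qed.

Lemma end_component_exists G (e : end_space G) F : finite_verts G F ->
  exists C, component (gminus G F) C /\ forall r, sval e r -> has_tail_in r C.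
Proof.
case: e => /= _ [r hr ->] hF; have [C [hC rC _]] := ray_equiv_refl hr hF.
exists C; split=> // s [_ /(_ _ hF) [C' [hC' rC' sC']]].
by rewrite (has_tail_in_common hC hC' rC rC').
Qed.

Lemma end_ray G (e : end_space G) : exists2 r, is_ray G r & sval e r.
Proof.
by case: e => /= _ [r hr ->]; exists r => //; split=> //; exact: ray_equiv_refl.
Qed.

Lemma end_componentP G (e : end_space G) F : finite_verts G F ->
  component (gminus G F) (end_component e F) /\
  forall r, sval e r -> has_tail_in r (end_component e F).
Proof. by move=> /(end_component_exists e)[C hC]; exact: (@xgetPex _ G [set C | _ /\ _] (ex_intro _ C hC)). Qed.

Lemma end_component_uniq G (e : end_space G) F C : finite_verts G F ->
  component (gminus G F) C -> (forall r, sval e r -> has_tail_in r C) ->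
  C = end_component e F.
Proof.
move=> /(end_componentP e)[hC' eC'] hC eC; have [r _ er] := end_ray e.
exact: has_tail_in_common hC hC' (eC _ er) (eC' _ er).
Qed.

Lemma end_nbhdS G (e : end_space G) F F' : finite_verts G F ->
  finite_verts G F' -> F `<=` F' -> end_nbhd e F' `<=` end_nbhd e F.
Proof.
move=> hF hF' FF' e' [r er rC']; exists r => //.
have [hC eC] := end_componentP e hF; have [hC' eC'] := end_componentP e hF'.
have [s _ es] := end_ray e.
have [m sC] := eC _ es; have [n sC'] := eC' _ es.
apply: is_ray_sub rC'; have [C'G cC' _] := hC'.
apply: (component_sub (x := s (m + n)) hC _ cC').
- apply: subgraph_trans C'G _; split=> [x [Gx nF']|x y [Gxy nx ny]].
    by split=> // /FF'.
  by split=> // /FF'.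
- exact: is_ray_verts sC.
- by rewrite addnC; exact: is_ray_verts sC'.
Qed.

End Graphs.

HB.instance Definition _ V (G : graph V) := gen_eqMixin (end_space G).
HB.instance Definition _ V (G : graph V) := gen_choiceMixin (end_space G).

Section EndTopology.
Context {V : Type} (G : graph V).

Lemma end_openT : end_open [set: end_space G].
Proof. by move=> e _; exists set0 => //; split=> //; exact: finite_set0. Qed.

Lemma end_openI : setI_closed (@end_open V G).
Proof.
move=> A B oA oB e [/oA[F hF FA] /oB[F' hF' FB]].
have hU : finite_verts G (F `|` F').
  split; first by rewrite finite_setU; split; [exact: hF.1|exact: hF'.1].
  by rewrite subUset; split; [exact: hF.2|exact: hF'.2].
exists (F `|` F') => // e' he'; split.
  by apply: FA; apply: end_nbhdS he' => //; exact: subsetUl.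
by apply: FB; apply: end_nbhdS he' => //; exact: subsetUr.
Qed.

Lemma end_open_bigU (I : Type) (f : I -> set (end_space G)) :
  (forall i, end_open (f i)) -> end_open (\bigcup_i f i).
Proof.
move=> of_ e [i _ /of_[F hF Ff]]; exists F => //.
by apply: subset_trans Ff _; exact: bigcup_sup.
Qed.

HB.instance Definition _ :=
  isOpenTopological.Build (end_space G) end_openT end_openI end_open_bigU.

Lemma open_endE : @open (end_space G) = @end_open V G.
Proof. by []. Qed.

End EndTopology.

Definition subdivision {W V : Type} (T : graph W) (H : graph V) :=
  exists (f : W -> V) (l : W -> W -> nat) (P : W -> W -> nat -> V),
    [/\ set_inj (gverts T) f,
        (* the path replacing the edge [uv]; both orientations of an edge
           carry the same path, up to reversal *)
        forall u v, gadj T u v ->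
          [/\ gpath H (P u v) (l u v) (f u) (f v), l v u = l u v
            & forall i, i <= l u v -> P v u i = P u v (l u v - i)],
        (forall u v w i, gadj T u v -> 0 < i < l u v -> gverts T w ->
          P u v i <> f w) /\
        (forall u v u' v' i j, gadj T u v -> gadj T u' v' ->
          0 < i < l u v -> 0 < j < l u' v' -> P u v i = P u' v' j ->
          (u = u' /\ v = v') \/ (u = v' /\ v = u')),
        forall x, gverts H x <->
          (exists2 w, gverts T w & x = f w) \/
          (exists u v i, [/\ gadj T u v, i <= l u v & x = P u v i])
      & forall x y, gadj H x y <->
          exists u v i, [/\ gadj T u v, i < l u v, x = P u v i
                          & y = P u v i.+1]].

Lemma rcons_neq (T : Type) (s : seq T) b : s <> rcons s b.
Proof. by move=> /(congr1 size); rewrite size_rcons => /n_Sn. Qed.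

Program Definition binary_tree : graph (seq bool) :=
  {| gverts := setT;
     gadj := fun s t => exists b, t = rcons s b \/ s = rcons t b |}.
Next Obligation. by move=> s t [b [|] ->]; exists b; [right|left]. Qed.
Next Obligation. by move=> s [b [] h]; exact: rcons_neq h. Qed.
Next Obligation. by []. Qed.

Section TopologicalNotions.
Context (T : topologicalType).

Definition open_cover (U : set (set T)) :=
  [/\ U !=set0, U `<=` open & \bigcup_(A in U) A = setT].

Definition rothberger :=
  forall U : nat -> set (set T), (forall n, open_cover (U n)) ->
    exists2 A : nat -> set T, (forall n, U n (A n)) & \bigcup_n A n = setT.

Definition lindelof :=
  forall U : set (set T), open_cover U ->
    exists W : set (set T),
      [/\ W `<=` U, countable W & \bigcup_(A in W) A = setT].

Definition scattered := forall A : set T, A !=set0 -> isolated A !=set0.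

Definition contains_copy (X : topologicalType) :=
  exists f : X -> T,
    [/\ injective f, continuous f
      & forall A : set X, open A ->
          exists2 B : set T, open B & f @` A = B `&` range f].

End TopologicalNotions.

(* Main.v *)
Require Import Defs.
From mathcomp Require Import finmap all_boot zify.
From mathcomp Require Import all_classical.
From mathcomp Require Import topology cantor.

Set Implicit Arguments.
Unset Strict Implicit.
Unset Printing Implicit Defensive.

Local Open Scope classical_set_scope.

(** The theorem compares two ways to test how rich the space of ends is: by
    countable selections and by binary trees.

    Condition (e) is the Rothberger property for the special covers of the end
    space by the components of [G \ F n], so (a) implies (e)
    ([rothberger_catching]). A copy of the Cantor space contradicts (e) by a
    diagonal argument ([catching_no_cantor]): compactness gives finite sets [F n]
    that determine the [n]-th digit of a point from the component in which its end
    lives, and the point that differs in the [n]-th digit from what the [n]-th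
    selected component allows is not caught.

    Conversely a Lindelof scattered space with a base of clopen sets is Rothberger
    ([scattered_rothberger]). It remains to find binary trees. An end-faithful
    subdivided binary tree yields a copy of the Cantor space, since its branches
    are rays whose ends depend on them injectively and continuously
    ([tree_cantor]). Such a tree is grown from any notion of large components which
    persists under deletion of further vertices and for which each large component
    splits into two ([splitting_tree]): inside a large component one finds a tripod,
    deletes it, and continues in two large components at the tips of its
    arms. There are two such notions. If a set of ends has no isolated point, call a
    component large when it contains one of these ends ([crowded_splitting]);
    hence (d) implies that the space is scattered. If a cover has no countable
    subcover, call a component large when no countable part of the cover
    suffices for its ends ([uncovered_splitting]). Under (e) this persists, and a
    large component that never splits would single out a component for every
    finite set. Such a direction comes from a ray ([direction_ray]), but the end of
    this ray has a neighbourhood covered by one set. So if (e) holds and the space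
    is not Lindelof, it contains a copy of the Cantor space, which (e) forbids
    ([catching_lindelof]). *)

(** * Connection by paths *)

Definition conn (V : Type) (K : graph V) (x y : V) :=
  exists n p, gpath K p n x y.

Section Connection.
Context {V : Type}.
Implicit Types (G H K C : graph V) (F A S : set V) (r s p : nat -> V).
Implicit Types (x y z : V).

Lemma conn_refl K x : conn K x x.
Proof. by exists 0, (fun=> x); exact: gpath_refl. Qed.

Lemma conn_sym K x y : conn K x y -> conn K y x.
Proof. by move=> [n [p xy]]; exists n; eexists; exact: gpath_rev xy. Qed.

Lemma conn_trans K y x z : conn K x y -> conn K y z -> conn K x z.
Proof. by move=> [n [p xy]] [m [q yz]]; exact: gpath_trans xy yz. Qed.

Lemma conn_sub H K x y : subgraph H K -> conn H x y -> conn K x y.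
Proof. by move=> HK [n [p /(gpath_sub HK) xy]]; exists n, p. Qed.

Lemma conn_adj K x y : gadj K x y -> conn K x y.
Proof.
by move=> xy; apply: gpath_cons xy (gpath_refl K y).
Qed.

Lemma conn_closed K A x y : A x ->
  (forall a b, A a -> gadj K a b -> A b) -> conn K x y -> A y.
Proof.
move=> Ax cA [n [p [p0 pn _ pa]]]; rewrite -pn.
have h i : i <= n -> A (p i).
  elim: i => [|i IH] ni; first by rewrite p0.
  by apply: cA (pa i ni); apply: IH; exact: ltnW.
exact: h.
Qed.

Lemma conn_closed_induced K A x y : A x ->
  (forall a b, A a -> gadj K a b -> A b) -> conn K x y ->
  conn (induced K A) x y.
Proof.
move=> Ax cA [n [p pxy]]; have [p0 pn pi pa] := pxy.
have h i : i <= n -> A (p i).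
  by move=> ni; apply: conn_closed Ax cA _; exists i, p; exact: gpath_take pxy.
exists n, p; split=> // i ni; split; first exact: pa.
  by apply: h; exact: ltnW.
exact: h.
Qed.

Lemma conn_vert K x y : conn K x y -> gverts K x -> gverts K y.
Proof.
move=> xy Kx; apply: conn_closed Kx _ xy => a b _ ab.
exact: gadj_verts (gadj_sym ab).
Qed.

Lemma gpath_verts K p n x y i : gpath K p n x y -> gverts K x -> i <= n ->
  gverts K (p i).
Proof.
move=> pxy Kx ni; apply: conn_vert Kx.
by exists i, p; exact: gpath_take pxy.
Qed.

Lemma gminus_sub K F F' : F `<=` F' -> subgraph (gminus K F') (gminus K F).
Proof. by move=> FF'; split=> [x [Kx nx]|x y [xy nx ny]]; split=> // /FF'. Qed.

Lemma gminus_sub0 K F : subgraph (gminus K F) K.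
Proof. exact: induced_sub. Qed.

Lemma gminus_subgraph H K F : subgraph H K ->
  subgraph (gminus H F) (gminus K F).
Proof. by move=> [h1 h2]; split=> [x [/h1]|x y [/h2]]. Qed.

Lemma gminus_verts K F : gminus K (F `&` gverts K) = gminus K F.
Proof.
apply: graph_eq; split=> [x [Kx nx]|x y [xy nx ny]].
- by split=> // Fx; apply: nx.
- have [Kx Ky] := (gadj_verts xy, gadj_verts (gadj_sym xy)).
  by split=> // Fx; [apply: nx|apply: ny].
- by split=> // -[].
- by split=> // -[].
Qed.

Lemma finite_vertsI K F : finite_set F -> finite_verts K (F `&` gverts K).
Proof. by move=> finF; split=> [|x []//]; exact: finite_setIl. Qed.

Lemma finite_bounded (g : V -> nat) F : finite_set F ->
  exists N, forall x, F x -> g x <= N.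
Proof.
move=> finF; have /finite_seqP[s es] := finite_image g finF.
exists (\max_(i <- s) i) => x Fx; have : (g @` F) (g x) by exists x.
by rewrite es /= => xs; exact: leq_bigmax_seq.
Qed.

(** * Components and ends in terms of connection *)

Lemma componentE K C x : component K C -> gverts C x ->
  C = induced K [set y | conn K x y].
Proof.
move=> hC Cx; have [[CK _] _ _] := hC.
have [A [hA eA]] := component_exists (CK _ Cx); rewrite -eA.
apply: (component_eq hC hA Cx); split; first exact: CK.
by rewrite eA; exact: conn_refl.
Qed.

Lemma component_vertsE K C x : component K C -> gverts C x ->
  gverts C = [set y | conn K x y].
Proof.
move=> hC Cx; rewrite (componentE hC Cx); apply/seteqP; split=> [y []//|y xy].
by split=> //; have [[CK _] _ _] := hC; apply: conn_vert xy _; exact: CK.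
Qed.

Lemma conn_component K x : gverts K x ->
  exists C, component K C /\ gverts C x.
Proof.
move=> Kx; have [A [hA eA]] := component_exists Kx.
by exists (induced K A); split=> //; split=> //; rewrite eA; exact: conn_refl.
Qed.

Lemma ray_conn K r i j : is_ray K r -> conn K (r i) (r j).
Proof.
move=> [ri ra]; have h k : conn K (r 0) (r k).
  elim: k => [|k IH]; first exact: conn_refl.
  exact: conn_trans IH (conn_adj (ra k)).
by apply: conn_trans (h j); apply: conn_sym.
Qed.

(** Components are named by any of their vertices; this says that [r] has a tail
    in the component of [x]. *)
Definition tail_conn K x r := exists n, forall i, n <= i -> conn K x (r i).

Lemma ray_tail_conn K r F : is_ray K r -> finite_set F ->
  exists n, [/\ gverts (gminus K F) (r n), tail_conn (gminus K F) (r n) r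
    & forall i, n <= i -> ~ F (r i)].
Proof.
move=> hr /ray_tail_minus/(_ hr)[n hn]; exists n; split.
- by have := is_ray_verts 0 hn; rewrite /tail addn0.
- exists n => i ni; have := ray_conn 0 (i - n) hn.
  by rewrite /tail addn0 subnKC.
- by move=> i ni; have [_] := is_ray_verts (i - n) hn; rewrite /tail subnKC.
Qed.

Lemma ray_eventually K r F : is_ray K r -> finite_set F ->
  exists n, forall i j, n <= i -> n <= j ->
    ~ F (r i) /\ conn (gminus K F) (r i) (r j).
Proof.
move=> hr finF; have [n [_ [k hk] nF]] := ray_tail_conn hr finF.
exists (n + k) => i j hi hj; split; first by apply: nF; lia.
apply: conn_trans (conn_sym (hk _ _)) (hk _ _); lia.
Qed.

Lemma tail_connW K x y r : conn K x y -> tail_conn K y r -> tail_conn K x r.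
Proof.
by move=> xy [n yr]; exists n => i /yr; exact: conn_trans.
Qed.

Lemma tail_conn_sub H K x r : subgraph H K -> tail_conn H x r -> tail_conn K x r.
Proof. by move=> HK [n h]; exists n => i /h; exact: conn_sub. Qed.

Lemma tail_conn_uniq K x y r : tail_conn K x r -> tail_conn K y r -> conn K x y.
Proof.
move=> [n hn] [m hm]; apply: conn_trans (hn (n + m) _) (conn_sym (hm _ _));
  by rewrite ?leq_addr ?leq_addl.
Qed.

Lemma has_tail_inP K F C x r : is_ray K r -> finite_set F ->
  component (gminus K F) C -> gverts C x ->
  has_tail_in r C <-> tail_conn (gminus K F) x r.
Proof.
move=> hr finF hC Cx; split=> [[n hn]|[n hn]].
  exists n => i ni; have := is_ray_verts (i - n) hn.
  by rewrite (component_vertsE hC Cx) /tail subnKC.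
have [m hm] := ray_tail_minus finF hr; exists (m + n).
have := is_ray_tail n hm; rewrite tail_tail (componentE hC Cx) => -[ri ra].
split=> // i; split; first exact: ra.
  by apply: hn; rewrite addnAC leq_addl.
by apply: hn; rewrite addnAC leq_addl.
Qed.

Lemma has_tail_in_vert C r : has_tail_in r C -> exists x, gverts C x.
Proof. by move=> [n /(is_ray_verts 0)]; eexists; eassumption. Qed.

(** Quantifying over all finite [F], also outside of [K], spares the check that
    [F] consists of vertices when [K] is a subgraph. *)
Lemma ray_equivP K r s : is_ray K r -> is_ray K s ->
  ray_equiv K r s <-> forall F, finite_set F ->
    exists n, forall i j, n <= i -> n <= j -> conn (gminus K F) (r i) (s j).
Proof.
move=> hr hs; split=> [rs F finF|rs F [finF FK]].
  have [C [hC rC sC]] := rs _ (finite_vertsI K finF).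
  rewrite gminus_verts in hC; have [x Cx] := has_tail_in_vert rC.
  move/(has_tail_inP hr finF hC Cx): rC => [n rn].
  move/(has_tail_inP hs finF hC Cx): sC => [m sm].
  exists (n + m) => i j hi hj.
  apply: conn_trans (conn_sym (rn i _)) (sm j _); lia.
have [n [rn hn _]] := ray_tail_conn hr finF.
have [C [hC Cx]] := conn_component rn; exists C; split=> //.
  exact/(has_tail_inP hr finF hC Cx).
apply/(has_tail_inP hs finF hC Cx); have [m hm] := rs F finF.
case: hn => k hk.
exists (n + m + k) => i hi.
apply: conn_trans (hk (n + m + k) _) (hm _ _ _ _); lia.
Qed.

Lemma ray_equiv_sub H K r s : subgraph H K -> is_ray H r -> is_ray H s ->
  ray_equiv H r s -> ray_equiv K r s.
Proof.
move=> HK hr hs /(ray_equivP hr hs) rs.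
apply/ray_equivP; [exact: is_ray_sub hr|exact: is_ray_sub hs|move=> F finF].
have [n hn] := rs F finF; exists n => i j ni nj.
exact: conn_sub (gminus_subgraph F HK) (hn i j ni nj).
Qed.

End Connection.

Section Ends.
Context {V : Type} (G : graph V).
Implicit Types (F A S : set V) (r s p : nat -> V) (e : end_space G).
Implicit Types (x y z : V).

(** The basic open sets: [end_nbhdE] identifies them with the neighbourhoods that
    generate the topology. Here one ray of [e] decides, because all rays of [e]
    have tails in the same component. *)
Definition ends_at F x : set (end_space G) :=
  [set e | exists2 r, sval e r & tail_conn (gminus G F) x r].

Lemma end_is_ray e r : sval e r -> is_ray G r.
Proof. by case: e => /= _ [s hs ->] []. Qed.

Lemma end_equiv e r s : sval e r -> sval e s -> ray_equiv G r s.
Proof.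
case: e => /= _ [t ht ->] [hr tr] [hs ts].
by apply: ray_equiv_trans ts; exact: ray_equiv_sym.
Qed.

Lemma end_equiv_in e r s : sval e r -> is_ray G s -> ray_equiv G r s ->
  sval e s.
Proof.
case: e => /= _ [t ht ->] [hr tr] hs rs; split=> //.
exact: ray_equiv_trans tr rs.
Qed.

Lemma end_eq e e' r s : sval e r -> sval e' s -> ray_equiv G r s -> e = e'.
Proof.
move=> er es rs.
have h (a b : end_space G) t u : sval a t -> sval b u -> ray_equiv G t u ->
    sval a `<=` sval b.
  move=> at_ bu tu q aq; apply: end_equiv_in bu (end_is_ray aq) _.
  apply: ray_equiv_trans (ray_equiv_sym tu) _; exact: end_equiv at_ aq.
have : sval e = sval e'.
  by apply/seteqP; split; [exact: h rs|exact: h (ray_equiv_sym rs)].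
case: e e' {h er es} => [a ha] [b hb] /= ab; subst b.
by congr exist; exact: Prop_irrelevance.
Qed.

Lemma ray_end r : is_ray G r -> exists e : end_space G, sval e r.
Proof.
move=> hr.
have he : is_end G [set s | is_ray G s /\ ray_equiv G r s] by exists r.
by exists (exist _ _ he); split=> //; exact: ray_equiv_refl.
Qed.

Lemma ends_at_ray F x e r : finite_set F -> ends_at F x e -> sval e r ->
  tail_conn (gminus G F) x r.
Proof.
move=> finF [s es [n hn]] er.
have /(ray_equivP (end_is_ray es) (end_is_ray er)) := end_equiv es er.
move=> /(_ F finF)[m hm]; exists (n + m) => i hi.
apply: conn_trans (hn (n + m) _) (hm _ _ _ _); lia.
Qed.

Lemma ends_at_exists F e : finite_set F ->
  exists x, [/\ gverts G x, ~ F x & ends_at F x e].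
Proof.
move=> finF; have [r hr er] := end_ray e.
have [n [[Gr nF] hn _]] := ray_tail_conn hr finF.
by exists (r n); split=> //; exists r.
Qed.

Lemma ends_at_uniq F x y e : finite_set F -> ends_at F x e -> ends_at F y e ->
  conn (gminus G F) x y.
Proof.
move=> finF hx [r er hy].
exact: tail_conn_uniq (ends_at_ray finF hx er) hy.
Qed.

Lemma ends_atW F x y : conn (gminus G F) x y -> ends_at F y `<=` ends_at F x.
Proof. by move=> xy e [r er yr]; exists r => //; exact: tail_connW yr. Qed.

Lemma ends_at_conn F x y : conn (gminus G F) x y -> ends_at F x = ends_at F y.
Proof.
by move=> xy; apply/seteqP; split; apply: ends_atW => //; exact: conn_sym.
Qed.

Lemma ends_at_sub F F' x : F `<=` F' -> ends_at F' x `<=` ends_at F x.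
Proof.
move=> FF' e [r er xr]; exists r => //.
by apply: tail_conn_sub xr; exact: gminus_sub.
Qed.

Lemma end_nbhdE F x e : finite_verts G F -> ends_at F x e ->
  end_nbhd e F = ends_at F x.
Proof.
move=> hF xe; have [hC eC] := end_componentP e hF; have [finF _] := hF.
have [r hr er] := end_ray e.
have := eC r er; set C := end_component e F in hC eC * => rC.
have [y Cy] := has_tail_in_vert rC.
have ye : ends_at F y e by exists r => //; apply/(has_tail_inP hr finF hC Cy).
rewrite (ends_at_conn (ends_at_uniq finF xe ye)).
apply/seteqP; split=> e' [s es hs]; first exists s => //.
  apply/(has_tail_inP (end_is_ray es) finF hC Cy).
  by exists 0; rewrite (_ : tail 0 s = s)//.
have /(has_tail_inP (end_is_ray es) finF hC Cy)[n hn] := hs.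
have ht := is_ray_tail n (end_is_ray es); exists (tail n s) => //.
apply: (end_equiv_in es ht).
apply/(ray_equivP (end_is_ray es) ht) => F' finF'.
have [m [_ [k hk] _]] := ray_tail_conn (end_is_ray es) finF'.
exists (m + n + k) => i j hi hj.
apply: conn_trans (conn_sym (hk _ _)) (hk _ _); lia.
Qed.

Lemma openP (U : set (end_space G)) : open U <->
  forall e, U e -> exists F x, [/\ finite_set F, ends_at F x e
                                 & ends_at F x `<=` U].
Proof.
rewrite open_endE; split=> oU e Ue.
  have [F hF FU] := oU e Ue; have [finF _] := hF.
  have [x [_ _ xe]] := ends_at_exists e finF.
  by exists F, x; split=> //; rewrite (end_nbhdE hF xe) in FU.
have [F [x [finF xe FU]]] := oU e Ue.
have hF := finite_vertsI G finF; exists (F `&` gverts G) => //.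
by rewrite (end_nbhdE (x := x)) // /ends_at gminus_verts.
Qed.

Lemma ends_at_open F x : finite_set F -> open (ends_at F x).
Proof. by move=> finF; apply/openP => e xe; exists F, x; split. Qed.

Lemma ends_at_closed F x : finite_set F -> closed (ends_at F x).
Proof.
move=> finF; rewrite -openC; apply/openP => e nxe.
have [y [_ _ ye]] := ends_at_exists e finF.
exists F, y; split=> // e' ye' xe'; apply: nxe.
by rewrite (ends_at_conn (ends_at_uniq finF xe' ye')).
Qed.

Lemma ends_separated e e' : e <> e' -> exists F x y,
  [/\ finite_set F, ends_at F x e, ends_at F y e' & ~ conn (gminus G F) x y].
Proof.
move=> ee'; apply: contrapT => h; apply: ee'.
have [r hr er] := end_ray e; have [s hs es] := end_ray e'.
apply: (end_eq er es); apply/ray_equivP => // F finF.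
have [x [_ _ xe]] := ends_at_exists e finF.
have [y [_ _ ye]] := ends_at_exists e' finF.
have [xy|nxy] := pselect (conn (gminus G F) x y); last first.
  by exfalso; apply: h; exists F, x, y.
have [n hn] := ends_at_ray finF xe er; have [m hm] := ends_at_ray finF ye es.
exists (n + m) => i j hi hj.
apply: conn_trans (conn_sym (hn i _)) (conn_trans xy (hm j _)); lia.
Qed.

Lemma end_space_hausdorff : hausdorff_space (end_space G).
Proof.
rewrite open_hausdorff => e e' /eqP/ends_separated[F [x [y [finF xe ye nxy]]]].
exists (ends_at F x, ends_at F y); first by rewrite !inE.
split; [exact: ends_at_open|exact: ends_at_open|apply/eqP].
by rewrite -subset0 => e'' [xe'' ye'']; exact: nxy (ends_at_uniq finF xe'' ye'').
Qed.

End Ends.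

(** * Scattered Lindelof spaces are Rothberger *)

Section Topology.
Context {T : topologicalType}.
Implicit Types (W K : set T) (U : nat -> set (set T)).

(** Covers are taken in the whole space, so that the property passes to arbitrary
    subsets. *)
Definition rothberger_set W := forall U, (forall n, open_cover (U n)) ->
  exists2 A : nat -> set T, (forall n, U n (A n)) & W `<=` \bigcup_n A n.

Lemma rothberger_lindelof : rothberger T -> lindelof T.
Proof.
move=> roth U cU; have [A UA AT] := roth (fun=> U) (fun=> cU).
exists (range A); split; first by move=> _ [n _ <-].
  exact: card_image_le.
by rewrite bigcup_image.
Qed.

(** Distribute the sequence of covers into countably many subsequences, one for
    each member of the family. *)
Lemma rothberger_bigcup (F : set (set T)) : countable F ->
  (forall W, F W -> rothberger_set W) -> rothberger_set (\bigcup_(W in F) W).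
Proof.
move=> /countable_injP[g g_inj] FR U cU.
have /choice[A hA] (k : nat) : exists A : nat -> set T,
    (forall i, U (pickle (k, i)) (A i)) /\
    forall W, F W -> g W = k -> W `<=` \bigcup_i A i.
  have [[W FW gW]|nW] := pselect (exists2 W, F W & g W = k); last first.
    have /choice[A hA] (i : nat) : exists B, U (pickle (k, i)) B.
      by have [[B UB] _ _] := cU (pickle (k, i)); exists B.
    by exists A; split=> // W FW gW; case: nW; exists W.
  have [A UA WA] := FR W FW (fun i => U (pickle (k, i))) (fun i => cU _).
  exists A; split=> // W' FW' gW'.
  by rewrite (g_inj W' W) ?inE // gW'.
have /choice[B hB] (n : nat) : exists B, U n B /\
    forall k i, n = pickle (k, i) -> B = A k i.
  have [[[k i] ->]|nki] := pselect (exists ki : nat * nat, n = pickle ki).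
    exists (A k i); split; first exact: (hA k).1.
    by move=> k' i' /(pcan_inj pickleK) [-> ->].
  have [[B UB] _ _] := cU n; exists B; split=> // k i e.
  by case: nki; exists (k, i).
exists B => [n|x [W FW Wx]]; first exact: (hB n).1.
have [i _ Ai] := (hA (g W)).2 W FW erefl x Wx.
by exists (pickle (g W, i)) => //; rewrite ((hB _).2 (g W) i erefl).
Qed.

Lemma rothberger_setS W K : W `<=` K -> rothberger_set K -> rothberger_set W.
Proof.
move=> WK RK U /RK[A UA KA]; exists A => //; exact: subset_trans KA.
Qed.

(** Add the complement of [K] to the sets [O] to get a cover of the space. *)
Lemma rothberger_closed K (O : set (set T)) : lindelof T -> closed K ->
  (forall W, O W -> open W /\ rothberger_set W) -> K `<=` \bigcup_(W in O) W ->
  rothberger_set K.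
Proof.
move=> lin cK hO KO.
have [|F [FU cF FT]] := lin (O `|` [set ~` K]).
  split; first by exists (~` K); right.
    by move=> W [/hO[]//|->]; rewrite /= openC.
  apply/seteqP; split=> // x _; have [Kx|nKx] := pselect (K x).
    by have [W OW Wx] := KO x Kx; exists W => //; left.
  by exists (~` K) => //; right.
have RF : rothberger_set (\bigcup_(W in F `&` O) W).
  apply: rothberger_bigcup => [|W [_ /hO[]]//].
  by apply: sub_countable cF; apply: subset_card_le => W [].
apply: rothberger_setS RF => x Kx.
have [W FW Wx] : (\bigcup_(A in F) A) x by rewrite FT.
by exists W => //; split=> //; have [//|eW] := FU W FW; rewrite eW in Wx.
Qed.

(** Let [O] be the union of the open sets with the Rothberger property; the
    Lindelof property reduces the claim to [O] being everything. Otherwise the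
    complement of [O] has an isolated point [p]; a clopen neighbourhood [U] of
    [p] with [U] minus [O] reduced to [p] is then Rothberger: spend the first
    cover on [p], what remains of [U] is a closed subset of [O]. *)
Lemma scattered_rothberger : lindelof T -> scattered T ->
  (forall (x : T) N, nbhs x N -> exists2 W, clopen W & W x /\ W `<=` N) ->
  rothberger T.
Proof.
move=> lin scat zd; set O := [set W | open W /\ rothberger_set W].
have hO W : O W -> open W /\ rothberger_set W by [].
suff OT : \bigcup_(W in O) W = setT.
  have RT : rothberger_set [set: T].
    by apply: (rothberger_closed lin closedT hO); rewrite OT.
  by move=> U /RT[A UA TA]; exists A => //; apply/seteqP; split.
apply: contrapT => OT.
have [p [/set_mem nOp [N Np NO]]] : isolated (~` \bigcup_(W in O) W) !=set0.
  apply: scat; apply: contrapT => /set0P/negP; rewrite negbK => /eqP.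
  by rewrite -setCT => /setC_inj.
have [W [oW cW] [Wp WN]] := zd p N Np.
apply: nOp; exists W => //; split=> // U cU.
have [_ oU0 /seteqP[_ /(_ p I)[A0 UA0 A0p]]] := cU 0.
have RK : rothberger_set (W `\` A0).
  apply: (rothberger_closed lin _ hO).
    rewrite setDE; apply: closedI => //; apply: open_closedC; exact: oU0.
  move=> x [Wx nA0x]; apply: contrapT => nOx; apply: nA0x.
  suff -> : x = p by [].
  have : (N `&` ~` \bigcup_(W in O) W) x by split=> //; exact: WN.
  by rewrite NO.
have [A UA WA] := RK (fun n => U n.+1) (fun n => cU _).
exists (fun n => if n is m.+1 then A m else A0) => [[|n]//|x Wx].
have [A0x|nA0x] := pselect (A0 x); first by exists 0.
by have [n _ An] := WA x (conj Wx nA0x); exists n.+1.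
Qed.

End Topology.

(** * The selection property of components *)

Definition catching (V : Type) (G : graph V) :=
  forall F : nat -> set V,
    (forall n, finite_verts G (F n)) -> (forall n, F n `<=` F n.+1) ->
    exists2 C : nat -> graph V,
      (forall n, component (gminus G (F n)) (C n)) &
      (forall r, is_ray G r -> exists n, has_tail_in r (C n)).

Section Catching.
Context {V : Type} (G : graph V).
Implicit Types (F : set V) (r : nat -> V) (e : end_space G).

Lemma component_inhabited F : exists C, component (gminus G F) C.
Proof.
have [[x Gx]|nx] := pselect (exists x, gverts (gminus G F) x).
  by have [C [hC _]] := conn_component Gx; exists C.
exists (gminus G F); split=> [|x y Gx|H HG _ GH]; first exact: subgraph_refl.
  by case: nx; exists x.
exact: graph_eq.
Qed.

(** Apply the Rothberger property to the partitions of the ends according to the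
    components of [G \ F n]. *)
Lemma rothberger_catching : rothberger (end_space G) -> catching G.
Proof.
move=> roth F hF _.
pose inC C : set (end_space G) := [set e | forall r, sval e r -> has_tail_in r C].
pose U n := [set inC C | C in [set C | component (gminus G (F n)) C]].
have [|A UA AT] := roth U.
  move=> n; have [C0 hC0] := component_inhabited (F n).
  have [finF _] := hF n; split; first by exists (inC C0), C0.
    move=> _ [C hC <-]; apply/openP => e Ce.
    have [r hr er] := end_ray e; have [x Cx] := has_tail_in_vert (Ce r er).
    exists (F n), x; split=> // [|e' xe' s es].
      by exists r => //; apply/(has_tail_inP hr finF hC Cx); exact: Ce.
    apply/(has_tail_inP (end_is_ray es) finF hC Cx).
    exact: ends_at_ray xe' es.
  apply/seteqP; split=> // e _; have [hC eC] := end_componentP e (hF n).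
  by exists (inC (end_component e (F n))) => //; exists (end_component e (F n)).
have /choice[C hC] (n : nat) : exists C, component (gminus G (F n)) C /\
  A n = inC C by have [C hC <-] := UA n; exists C.
exists C => [n|r hr]; first exact: (hC n).1.
have [e er] := ray_end hr.
have [n _] : (\bigcup_n A n) e by rewrite AT.
by rewrite (hC n).2 => /(_ r er); exists n.
Qed.

(** Only the empty graph is a component without a vertex to name it, and then the
    selected set of ends is empty. *)
Lemma catching_ends (F : nat -> set V) : catching G ->
  (forall n, finite_set (F n)) -> (forall n, F n `<=` F n.+1) ->
  exists P : nat -> set (end_space G),
    (forall n, P n = set0 \/ exists x, P n = ends_at (F n) x) /\
    \bigcup_n P n = setT.
Proof.
move=> hG finF incF.
have [||C hC CT] := hG (fun n => F n `&` gverts G).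
- by move=> n; exact: finite_vertsI.
- by move=> n x [Fx Gx]; split=> //; exact: incF.
have /choice[P hP] (n : nat) : exists P : set (end_space G),
    (P = set0 \/ exists x, P = ends_at (F n) x) /\
    forall e r, sval e r -> has_tail_in r (C n) -> P e.
  have := hC n; rewrite gminus_verts => hCn.
  have [[x Cx]|nx] := pselect (exists x, gverts (C n) x); last first.
    exists set0; split=> [|e r _ /has_tail_in_vert//]; by left.
  exists (ends_at (F n) x); split=> [|e r er rC]; first by right; exists x.
  by exists r => //; apply/(has_tail_inP (end_is_ray er) (finF n) hCn Cx).
exists P; split=> [n|]; first exact: (hP n).1.
apply/seteqP; split=> // e _; have [r hr er] := end_ray e.
by have [n rC] := CT r hr; exists n => //; exact: (hP n).2 rC.
Qed.

End Catching.

(** * The Cantor space in an end space *)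

Section Cantor.
Context {V : Type} (G : graph V).
Implicit Types (F : set V) (r : nat -> V) (e : end_space G).

(** Compactness yields one finite set deciding the [n]-th digit. *)
Lemma cantor_digit (f : cantor_space -> end_space G) n :
  injective f -> continuous f ->
  (forall A : set cantor_space, open A ->
     exists2 B, open B & f @` A = B `&` range f) ->
  exists F, finite_set F /\ forall x a b, ends_at F x (f a) ->
    ends_at F x (f b) -> a n = b n.
Proof.
move=> f_inj f_cont f_open.
have od (b : bool) : open [set a : cantor_space | a n = b].
  have -> : [set a : cantor_space | a n = b] =
    (proj n : cantor_space -> bool) @^-1` [set b] by [].
  apply: open_comp; last exact: discrete_open.
  by move=> a _; exact: proj_continuous.
have /choice[Fx hFx] (a : cantor_space) : exists Fx : set V * V,
    [/\ finite_set Fx.1, ends_at Fx.1 Fx.2 (f a) &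
        forall b, ends_at Fx.1 Fx.2 (f b) -> b n = a n].
  have [B oB eB] := f_open _ (od (a n)).
  have Ba : B (f a).
    by have : (f @` [set b : cantor_space | b n = a n]) (f a);
      [exists a|rewrite eB => -[]].
  have [F [x [finF xa FB]]] := (openP B).1 oB _ Ba; exists (F, x); split=> // b xb.
  have : (B `&` range f) (f b) by split; [exact: FB|exists b].
  by rewrite -eB => -[b' b'n /f_inj <-].
have := cantor_space_compact; rewrite compact_cover => /(_ cantor_space setT
  (fun a => f @^-1` ends_at (Fx a).1 (Fx a).2)).
case=> [a _|a _|D _ DT].
- apply: open_comp; first by move=> b _; exact: f_cont.
  by apply: ends_at_open; have [] := hFx a.
- by exists a => //=; have [] := hFx a.
exists (\bigcup_(a in [set` D]) (Fx a).1); split.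
  by apply: bigcup_finite => [|a _]; [exact: finite_fset|have [] := hFx a].
move=> x a b xa xb; have [c Dc ca] := DT a I; have [finF _ hc] := hFx c.
rewrite (hc a ca) -(hc b) //.
have FD : (Fx c).1 `<=` \bigcup_(a in [set` D]) (Fx a).1.
  by move=> v Fv; exists c.
have xc := ends_at_uniq finF (ends_at_sub FD xa) ca.
rewrite -(ends_at_conn xc); exact: ends_at_sub FD _ xb.
Qed.

(** Against the [n]-th selected component, choose the digit that it does not
    contain. *)
Lemma catching_no_cantor : catching G ->
  ~ contains_copy (end_space G) cantor_space.
Proof.
move=> hG [f [f_inj f_cont f_open]].
have /choice[F hF] := fun n => cantor_digit n f_inj f_cont f_open.
pose F' n := \bigcup_(k in `I_n.+1) F k.
have FF' n : F n `<=` F' n by apply: bigcup_sup; rewrite /= ltnS.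
have [|n x [k kn Fx]|P [hP PT]] := catching_ends (F := F') hG.
- by move=> n; apply: bigcup_finite => [|k _]; [exact: finite_II|have [] := hF k].
- by exists k => //; exact: leq_trans kn _.
have same n a b : P n (f a) -> P n (f b) -> a n = b n.
  case: (hP n) => [->//|[x ->]] xa xb; have [_] := hF n.
  by apply; apply: ends_at_sub (FF' n) _ _; [exact: xa|exact: xb].
pose c : cantor_space := fun n => ~~ `[< exists2 a, a n = true & P n (f a) >].
have [n _ Pn] : (\bigcup_n P n) (f c) by rewrite PT.
have cn : c n = ~~ `[< exists2 a, a n = true & P n (f a) >] by [].
move: cn; case: asboolP => [[a an Pa]|na] /= cn.
  by rewrite (same n c a Pn Pa) an in cn.
by apply: na; exists c.
Qed.

(** The image of a closed set is compact, hence closed, so that the inverse is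
    continuous as well. *)
Lemma cantor_copy (f : cantor_space -> end_space G) :
  injective f -> continuous f -> contains_copy (end_space G) cantor_space.
Proof.
move=> f_inj f_cont; exists f; split=> // A oA.
have kA : compact (~` A).
  apply: (subclosed_compact _ cantor_space_compact) => //.
  exact: open_closedC.
have : compact (f @` ~` A).
  by apply: continuous_compact kA; exact: continuous_subspaceT.
move=> /(compact_closed (@end_space_hausdorff V G)) cA.
exists (~` (f @` ~` A)); first exact: closed_openC.
apply/seteqP; split=> [_ [a Aa <-]|e [na [a _ ae]]].
  by split; [move=> [b nb /f_inj ba]; apply: nb; rewrite ba|exists a].
by exists a => //; apply: contrapT => nA; apply: na; exists a.
Qed.

Lemma end_space_rothberger : lindelof (end_space G) ->
  scattered (end_space G) -> rothberger (end_space G).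
Proof.
move=> lin scat; apply: scattered_rothberger => // e N.
rewrite nbhsE => -[U [oU Ue] UN].
have [F [x [finF xe FU]]] := (openP U).1 oU e Ue.
exists (ends_at F x); first by split; [exact: ends_at_open|exact: ends_at_closed].
by split=> //; exact: subset_trans UN.
Qed.

End Cantor.

(** * Rays from nested sets *)

Section Rays.
Context {V : Type}.
Implicit Types (G H K : graph V) (F : set V) (p r : nat -> V).

(** Concatenate infinitely many paths: the path out of the state [s] meets the next
    set [D s'] only in its last vertex, and all later paths stay in [D s'], so that
    the concatenation is injective. *)
Lemma ray_of_steps (S : Type) K (D : S -> set V) (v : S -> V)
    (R : S -> S -> Prop) (s0 : S) :
  (forall s, exists s', [/\ R s s', D s' `<=` D s &
     exists n p, [/\ 0 < n, gpath K p n (v s) (v s'),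
       (forall i, i <= n -> D s (p i)) & (forall i, i < n -> ~ D s' (p i))]]) ->
  exists (sigma : nat -> S) r, [/\ sigma 0 = s0,
    forall k, R (sigma k) (sigma k.+1), is_ray K r &
    forall k, exists n, [/\ k <= n, r n = v (sigma k) &
                         forall i, n <= i -> D (sigma k) (r i)]].
Proof.
move=> /choice[nxt] h.
have /choice[lp {}h] (s : S) : exists lp : nat * (nat -> V),
    [/\ R s (nxt s), D (nxt s) `<=` D s & [/\ 0 < lp.1,
       gpath K lp.2 lp.1 (v s) (v (nxt s)),
       (forall i, i <= lp.1 -> D s (lp.2 i)) &
       (forall i, i < lp.1 -> ~ D (nxt s) (lp.2 i))]].
  by have [? ? [n [p np]]] := h s; exists (n, p).
pose sigma k := iter k nxt s0.
pose l k := (lp (sigma k)).1; pose p k := (lp (sigma k)).2.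
pose step ki := if ki.2.+1 < l ki.1 then (ki.1, ki.2.+1) else (ki.1.+1, 0).
pose st j := iter j step (0, 0).
have l_gt0 k : 0 < l k by have [_ _ []] := h (sigma k).
have st_lt j : (st j).2 < l (st j).1.
  elim: j => [|j IH] /=; first exact: l_gt0.
  by rewrite /step; case: ifP => //= _; exact: l_gt0.
have Dmono k k' : k <= k' -> D (sigma k') `<=` D (sigma k).
  move=> /subnK <-; elim: (k' - k) => [//|m IH].
  by apply: subset_trans IH; have [_] := h (sigma (m + k)).
pose r j := p (st j).1 (st j).2.
have Dr j : D (sigma (st j).1) (r j).
  by have [_ _ [_ _ hD _]] := h (sigma (st j).1); apply: hD; exact: ltnW.
have st_mono j j' : j < j' -> (st j).1 < (st j').1 \/
    (st j).1 = (st j').1 /\ (st j).2 < (st j').2.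
  elim: j' => // j' IH; rewrite ltnS leq_eqVlt => /orP[/eqP->|/IH {}IH].
    by rewrite /= /step; case: ifP => /= _; [right|left].
  by rewrite /= /step -/(st j'); case: ifP => /= _; lia.
have r_neq j j' : j < j' -> r j <> r j'.
  move=> /st_mono[kk'|[kk' ii']] rr.
    have [_ _ [_ _ _ nD]] := h (sigma (st j).1).
    have : ~ D (sigma (st j).1.+1) (r j) by exact: nD (st_lt j).
    by apply; rewrite rr; exact: Dmono kk' _ (Dr j').
  have [_ _ [_ [_ _ p_inj _] _ _]] := h (sigma (st j).1).
  have lt' := st_lt j'; rewrite -kk' in lt'; rewrite /r -kk' in rr.
  by have := p_inj _ _ (ltnW (st_lt j)) (ltnW lt') rr; lia.
have st_reach k : exists2 j, k <= j & st j = (k, 0).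
  elim: k => [|k [j kj stj]]; first by exists 0.
  have st_add i : i < l k -> st (j + i) = (k, i).
    elim: i => [|i IH] li; first by rewrite addn0.
    by rewrite addnS /st iterS -/(st _) IH ?(ltnW li) // /step /= li.
  exists (j + l k); first by have := l_gt0 k; lia.
  have -> : j + l k = (j + (l k).-1).+1 by have := l_gt0 k; lia.
  rewrite /st iterS -/(st _) st_add ?prednK // /step /= prednK //.
  by rewrite ltnn.
exists sigma, r; split=> //.
- by move=> k; have [] := h (sigma k).
- split=> [j j' rr|j].
    have [jj'|jj'|//] := ltngtP j j'; first by case: (r_neq _ _ jj').
    by case: (r_neq _ _ jj').
  have [_ _ [_ [p0 pl _ pa] _ _]] := h (sigma (st j).1).
  have := pa _ (st_lt j); rewrite -/(r j).
  have -> : (lp (sigma (st j).1)).2 (st j).2.+1 = r j.+1 => //.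
  rewrite /r /st iterS -/(st j) /step; case: ifP => //= lt.
  have -> : (st j).2.+1 = l (st j).1 by have := st_lt j; lia.
  rewrite pl; have [_ _ [_ [p0' _ _ _] _ _]] := h (sigma (st j).1.+1).
  by rewrite -[LHS]/(v (sigma (st j).1.+1)) -p0'.
- move=> k; have [j kj stj] := st_reach k; exists j; split=> //.
    rewrite /r stj; have [_ _ [_ [p0 _ _ _] _ _]] := h (sigma k).
    by rewrite -p0.
  move=> i; rewrite leq_eqVlt => /orP[/eqP<-|/st_mono].
    by have := Dr j; rewrite stj.
  rewrite stj /= => hk; apply: Dmono (Dr i); lia.
Qed.

Lemma gpath_first_entry K (A : set V) p n x y : gpath K p n x y -> A y ->
  exists2 m, m <= n & A (p m) /\ forall i, i < m -> ~ A (p i).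
Proof.
move=> [_ pn _ _] Ay.
have exA : exists m, `[< A (p m) >] by exists n; apply/asboolP; rewrite pn.
case: (ex_minnP exA) => m /asboolP Am minm; exists m.
  by apply: minm; apply/asboolP; rewrite pn.
by split=> // i im /asboolP/minm; rewrite leqNgt im.
Qed.

(** Leave the current vertex behind in a later set of the sequence; a path inside
    the present set, stopped at its first vertex in the later one, is one step. *)
Lemma nested_ray K (D : nat -> set V) :
  (forall n, D n.+1 `<=` D n) -> (forall n, D n !=set0) ->
  (forall n x y, D n x -> D n y -> conn (induced K (D n)) x y) ->
  (forall x, exists n, ~ D n x) ->
  exists2 r, is_ray K r & forall n, exists m, forall i, m <= i -> D n (r i).
Proof.
move=> decD neD connD exitD.
have Dmono k k' : k <= k' -> D k' `<=` D k.
  move=> /subnK <-; elim: (k' - k) => [//|m IH]; exact: subset_trans (decD _) IH.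
have [x0 Dx0] := neD 0.
pose S := {nx : nat * V | D nx.1 nx.2}.
have [|sigma [r [_ incr hr hD]]] := @ray_of_steps S K
  (fun s => D (sval s).1) (fun s => (sval s).2)
  (fun s s' => (sval s).1 < (sval s').1) (exist _ (0, x0) Dx0).
  move=> [[n x] /= Dx]; have [m nDm] := exitD x.
  have nm : n < m.
    by rewrite ltnNge; apply/negP => mn; exact: nDm (Dmono _ _ mn _ Dx).
  have [y Dy] := neD m.
  have [k [p pxy]] := connD n x y Dx (Dmono _ _ (ltnW nm) _ Dy).
  have [j jk [Dj nDj]] := gpath_first_entry pxy Dy.
  exists (exist _ (m, p j) Dj); split=> //=; first exact/Dmono/ltnW.
  have [p0 _ _ pa] := pxy.
  have j_gt0 : 0 < j.
    by case: j jk Dj {nDj} => // _; rewrite p0.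
  exists j, p; split=> //.
    apply: gpath_take jk _; exact: gpath_sub (@induced_sub _ _ _) pxy.
  case=> [_|i ij]; first by rewrite p0.
  by have [] := pa i (leq_trans ij jk).
exists r => // n; have [k nk] : exists k, n <= (sval (sigma k)).1.
  elim: n => [|n [k nk]]; first by exists 0.
  by exists k.+1; exact: leq_ltn_trans nk (incr k).
have [m [_ _ hm]] := hD k; exists m => i mi; exact: Dmono nk _ (hm i mi).
Qed.

End Rays.

(** * Directions come from rays *)

Section Directions.
Context {V : Type} (G : graph V).
Implicit Types (F : set V) (x y z w u : V).

(** [big F x] is to be read: the component of [x] in [G \ F] is large. *)
Record persistent (big : set V -> V -> Prop) := Persistent {
  big_vert : forall F x, finite_set F -> big F x -> gverts G x /\ ~ F x;
  big_conn : forall F x y, finite_set F -> big F x ->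
    conn (gminus G F) x y -> big F y;
  big_refine : forall F F' x, finite_set F -> finite_set F' -> F `<=` F' ->
    big F x -> exists2 y, conn (gminus G F) x y & big F' y }.

Variable big : set V -> V -> Prop.
Hypothesis hbig : persistent big.
Variables (F0 : set V) (x0 : V).
Hypothesis finF0 : finite_set F0.
Hypothesis big0 : big F0 x0.
Hypothesis unsplit : forall F y z, finite_set F -> F0 `<=` F ->
  conn (gminus G F0) x0 y -> conn (gminus G F0) x0 z -> big F y -> big F z ->
  conn (gminus G F) y z.

Let D F : set V := [set y | conn (gminus G F0) x0 y /\ big F y].

Lemma dir_nonempty F : finite_set F -> F0 `<=` F -> exists y, D F y.
Proof.
by move=> finF FF; have [y] := big_refine hbig finF0 finF FF big0; exists y.
Qed.

Lemma dir_closed F y z : finite_set F -> F0 `<=` F -> D F y ->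
  conn (gminus G F) y z -> D F z.
Proof.
move=> finF FF [xy Fy] yz; split; last exact: big_conn Fy yz.
by apply: conn_trans xy _; apply: conn_sub yz; exact: gminus_sub.
Qed.

Lemma dir_conn F y z : finite_set F -> F0 `<=` F -> D F y -> D F z ->
  conn (gminus G F) y z.
Proof. by move=> finF FF [xy Fy] [xz Fz]; exact: unsplit. Qed.

Lemma dir_mono F F' : finite_set F -> finite_set F' -> F0 `<=` F ->
  F `<=` F' -> D F' `<=` D F.
Proof.
move=> finF finF' FF FF' y [xy F'y]; split=> //.
have F0F' := subset_trans FF FF'.
have [z xz Fz] := big_refine hbig finF0 finF FF big0.
have [t zt F't] := big_refine hbig finF finF' FF' Fz.
have xt : conn (gminus G F0) x0 t.
  by apply: conn_trans xz _; apply: conn_sub zt; exact: gminus_sub.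
apply: (big_conn hbig finF Fz); apply: conn_trans zt _.
by apply: conn_sub (unsplit finF' F0F' xt xy F't F'y); exact: gminus_sub.
Qed.

(** The vertices that no finite set separates from the direction. *)
Let W : set V := [set w | conn (gminus G F0) x0 w /\
  forall F, finite_set F -> F0 `<=` F -> ~ F w -> D F w].

(** A ray through infinitely many of them follows the direction: it has a tail in
    one component of [G \ F], and this tail meets such a vertex. *)
Lemma dir_ray_dominated : infinite_set W ->
  exists2 r, is_ray G r & forall F, finite_set F -> F0 `<=` F ->
    exists n, forall i, n <= i -> D F (r i).
Proof.
move=> infW.
have pickW F : finite_set F -> exists2 w, W w & ~ F w.
  move=> finF; apply: contrapT => h; apply: infW; apply: sub_finite_set finF.
  by move=> w Ww; apply: contrapT => nFw; apply: h; exists w.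
have [w0 Ww0 nw0] := pickW _ finF0.
pose P (Fw : set V * V) := [/\ finite_set Fw.1, F0 `<=` Fw.1, W Fw.2 & ~ Fw.1 Fw.2].
have P0 : P (F0, w0) by split.
have [|sigma [r [_ incr hr hD]]] := @ray_of_steps V {Fw | P Fw} G
  (fun s => D (sval s).1) (fun s => (sval s).2)
  (fun s s' => (sval s').1 (sval s).2 /\ (sval s).1 `<=` (sval s').1)
  (exist _ (F0, w0) P0).
  move=> [[F w] /= [/= finF FF Ww nFw]].
  have [|w' Ww' nw'] := pickW (F `|` [set w]).
    by rewrite finite_setU; split=> //; exact: finite_set1.
  have Dw : D F w by exact: Ww.2.
  have Dw' : D F w' by apply: Ww'.2 => // Fw'; apply: nw'; left.
  have [n [p pww']] := dir_conn finF FF Dw Dw'.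
  have [p0 pn p_inj pa] := pww'.
  have n_gt0 : 0 < n.
    case: n pn {p_inj pa pww'} => // pn; case: nw'; right.
    by rewrite -pn p0.
  pose F' := F `|` [set p i | i in `I_n].
  have finF' : finite_set F'.
    by rewrite finite_setU; split=> //; apply: finite_image; exact: finite_II.
  have FF' : F `<=` F' by left.
  have nF'w' : ~ F' w'.
    move=> [Fw'|[i /= i_n pi]]; first by apply: nw'; left.
    have := p_inj i n (ltnW i_n) (leqnn _); rewrite pi pn => /(_ erefl) e.
    by rewrite e ltnn in i_n.
  have P' : P (F', w') by split=> //=; exact: subset_trans FF'.
  exists (exist _ _ P'); split=> /=.
  - by split=> //; right; exists 0.
  - by apply: dir_mono => //.
  - exists n, p; split=> //; first exact: gpath_sub (gminus_sub0 _ _) pww'.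
      move=> i i_n; apply: (dir_closed _ _ Dw) => //.
      by exists i, p; exact: gpath_take pww'.
    move=> i i_n [_ /(big_vert hbig finF')[_]]; apply.
    by right; exists i.
exists r => // F finF FF.
have [n hn] := ray_eventually hr finF; exists n => i ni.
have [m [nm rm _]] := hD n; have [nFm rmi] := hn m i nm ni.
apply: dir_closed rmi => //.
have [_ hW] : W (r m) by rewrite rm; case: (sigma n) => -[? ?] [].
exact: hW.
Qed.

(** Otherwise absorb these finitely many vertices, and keep adding to [F n]
    finite sets that separate its other vertices from the direction. A vertex at
    distance [i] from a vertex in [F 1] is then outside of [D (F i.+1)], so that
    the sets [D (F n)] have empty intersection. *)
Lemma dir_ray_undominated : finite_set W ->
  exists2 r, is_ray G r & forall F, finite_set F -> F0 `<=` F ->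
    exists n, forall i, n <= i -> D F (r i).
Proof.
move=> finW.
have /choice[sep hsep] (u : V) : exists S, finite_set S /\
    (conn (gminus G F0) x0 u -> ~ W u -> [/\ F0 `<=` S, ~ S u & ~ D S u]).
  have [[xu nWu]|h] := pselect (conn (gminus G F0) x0 u /\ ~ W u); last first.
    by exists set0; split=> // xu nWu; case: h.
  apply: contrapT => h; apply: nWu; split=> // S finS FS nSu.
  by apply: contrapT => nD; apply: h; exists S; split.
pose F1 := F0 `|` W.
have finF1 : finite_set F1 by rewrite finite_setU.
have F01 : F0 `<=` F1 by left.
have [v Dv] := dir_nonempty finF1 F01.
pose F := fix F n := if n is m.+1 then F m `|` \bigcup_(u in F m) sep u
                     else F1 `|` [set v].
have finF n : finite_set (F n).
  elim: n => [|n IH] /=.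
    by rewrite finite_setU; split=> //; exact: finite_set1.
  rewrite finite_setU; split=> //; apply: bigcup_finite => // u _.
  exact: (hsep u).1.
have incF n : F n `<=` F n.+1 by left.
have F1F n : F1 `<=` F n.
  by elim: n => [|n IH]; [left|exact: subset_trans (incF n)].
have F0F n : F0 `<=` F n by exact: subset_trans F01 (F1F n).
have decD n : D (F n.+1) `<=` D (F n) by exact: dir_mono.
have exitD x : exists n, ~ D (F n) x.
  have [Dx|] := pselect (D (F 0) x); last by exists 0.
  have [n [q qvx]] : conn (gminus G F1) v x.
    apply: dir_conn => //; exact: dir_mono Dx.
  have [q0 qn _ qa] := qvx.
  have Dq i : i <= n -> D F1 (q i).
    move=> i_n; apply: (dir_closed _ _ Dv) => //.
    by exists i, q; exact: gpath_take qvx.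
  have nD F' y : finite_set F' -> F' y -> ~ D F' y.
    by move=> finF' F'y [_ /(big_vert hbig finF')[]].
  exists n; rewrite -qn.
  have h i : i <= n -> ~ D (F i) (q i).
    elim: i => [_|i IH i_n].
      by apply: nD => //; rewrite q0; right.
    move=> Dqi; have {}IH := IH (ltnW i_n).
    have Dqi' : D (F i) (q i.+1) := decD _ _ Dqi.
    have [adj nFq _] := qa i i_n.
    have Fqi : F i (q i).
      apply: contrapT => nFqi; apply: IH; apply: (dir_closed _ _ Dqi') => //.
      apply/conn_sym/conn_adj; split=> //.
      by have [_ /(big_vert hbig (finF i))[]] := Dqi'.
    have [xq _] := Dq i (ltnW i_n).
    have nWq : ~ W (q i) by move=> Wq; apply: nFq; right.
    have [F0S nSq nDq] := (hsep (q i)).2 xq nWq; apply: nDq.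
    have [finS _] := hsep (q i).
    have SF : sep (q i) `<=` F i.+1 by move=> u Su; right; exists (q i).
    have DSq : D (sep (q i)) (q i.+1) by apply: dir_mono Dqi.
    apply: (dir_closed _ _ DSq) => //; apply/conn_sym/conn_adj; split=> //.
    by have [_ /(big_vert hbig finS)[]] := DSq.
  exact: h.
have [||r hr rD] := nested_ray (K := G) decD _ _ exitD.
- by move=> n; exact: dir_nonempty.
- move=> n x y Dx Dy.
  have : conn (induced (gminus G (F n)) (D (F n))) x y.
    apply: conn_closed_induced (dir_conn (finF n) (F0F n) Dx Dy) => //.
    by move=> a b Da ab; apply: (dir_closed _ _ Da) => //; exact: conn_adj.
  by apply: conn_sub; split=> [a [[Ga _] Da]|a b [[ab _ _] Da Db]].
exists r => // S finS FS.
have Fmono m n : m <= n -> D (F n) `<=` D (F m).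
  move=> /subnK <-; elim: (n - m) => [//|k IH]; exact: subset_trans (decD _) IH.
have [n nS] : exists n, forall u, S u -> ~ D (F n) u.
  have /choice[ex hex] := exitD.
  have [N hN] := finite_bounded ex finS.
  by exists N => u /hN uN /(Fmono _ _ uN)/hex.
have [m hm] := rD n; exists m => i mi.
have finU : finite_set (S `|` F n) by rewrite finite_setU.
have F0U : F0 `<=` S `|` F n by move=> u /FS; left.
have [z Dz] := dir_nonempty finU F0U.
have DSz : D S z by apply: dir_mono Dz => //; left.
have Dnz : D (F n) z by apply: dir_mono Dz => //; right.
apply: (dir_closed _ _ DSz) => //.
have [a b Da ab|k [p pzr]] := @conn_closed_induced V (gminus G (F n)) (D (F n))
    z (r i) Dnz _ (dir_conn (finF n) (F0F n) Dnz (hm i mi)).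
  by apply: (dir_closed _ _ Da) => //; exact: conn_adj.
exists k, p; have [p0 pk p_inj pa] := pzr; split=> // j jk.
have [[ab _ _] Da Db] := pa j jk.
by split=> //; [move/nS: Da|move/nS: Db].
Qed.

(** A choice of one large component for each finite set, decreasing in the set, is
    induced by a ray. *)
Lemma direction_ray : exists2 r, is_ray G r &
  forall F, finite_set F -> F0 `<=` F ->
    exists n, forall i, n <= i -> D F (r i).
Proof.
have [|] := pselect (finite_set W); first exact: dir_ray_undominated.
exact: dir_ray_dominated.
Qed.

End Directions.

(** * Two sources of splitting components *)

Definition splitting (V : Type) (G : graph V) (big : set V -> V -> Prop) :=
  forall F x, finite_set F -> big F x -> exists F' y z,
    [/\ finite_set F', F `<=` F',
        conn (gminus G F) x y /\ conn (gminus G F) x z,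
        big F' y /\ big F' z & ~ conn (gminus G F') y z].

Section Sources.
Context {V : Type} (G : graph V).
Implicit Types (F : set V) (x y z : V) (e : end_space G).

Lemma conn_gminus_vert F x y : conn (gminus G F) x y ->
  gverts G x /\ ~ F x -> gverts G y /\ ~ F y.
Proof. by move=> xy Gx; exact: conn_vert xy Gx. Qed.

(** Call a component large when it contains an end of [A]; no end of [A] being
    isolated, it contains a second one, and the two can be separated. *)
Lemma crowded_splitting (A : set (end_space G)) : A !=set0 ->
  isolated A = set0 ->
  exists big, [/\ persistent G big, splitting G big & exists x, big set0 x].
Proof.
move=> [e0 Ae0] isoA.
exists (fun F x => (gverts G x /\ ~ F x) /\ exists2 e, A e & ends_at F x e).
split; first split.
- by move=> F x _ [].
- move=> F x y finF [Gx [e Ae xe]] xy; split; first exact: conn_gminus_vert Gx.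
  by exists e => //; rewrite -(ends_at_conn xy).
- move=> F F' x finF finF' FF' [_ [e Ae xe]].
  have [y [Gy F'y ye]] := ends_at_exists e finF'.
  exists y; last by split=> //; exists e.
  exact: ends_at_uniq finF xe (ends_at_sub FF' ye).
- move=> F x finF [_ [e Ae xe]].
  have [e' [xe' Ae'] ee'] : exists2 e', (ends_at F x `&` A) e' & e <> e'.
    apply: contrapT => h; suff : isolated A e by rewrite isoA.
    split; first exact: mem_set.
    exists (ends_at F x).
      by apply: open_nbhs_nbhs; split=> //; exact: ends_at_open.
    apply/seteqP; split=> [e' he'|_ ->//].
    by apply: contrapT => ne; apply: h; exists e' => // ee'; apply: ne.
  have [F1 [x1 [y1 [finF1 xe1 ye1 nxy]]]] := ends_separated ee'.
  have finF' : finite_set (F `|` F1) by rewrite finite_setU.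
  have FF' : F `<=` F `|` F1 by left.
  have FF1 : F1 `<=` F `|` F1 by right.
  have [y [Gy Fy ye]] := ends_at_exists e finF'.
  have [z [Gz Fz ze]] := ends_at_exists e' finF'.
  exists (F `|` F1), y, z; split=> //.
  + split; first exact: ends_at_uniq finF xe (ends_at_sub FF' ye).
    exact: ends_at_uniq finF xe' (ends_at_sub FF' ze).
  + by split; split=> //; [exists e|exists e'].
  + move=> /(conn_sub (gminus_sub G FF1)) yz; apply: nxy.
    apply: conn_trans (ends_at_uniq finF1 xe1 (ends_at_sub FF1 ye)) _.
    apply: conn_trans yz _.
    exact: ends_at_uniq finF1 (ends_at_sub FF1 ze) ye1.
- have [x [Gx nx xe]] := ends_at_exists e0 (finite_set0 V).
  by exists x; split=> //; exists e0.
Qed.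

(** Call a component large when no countable part of the cover covers its ends.
    Catching rays along a constant sequence shows that only countably many
    components of [G \ F] contain rays, hence persistence. Without splitting, the
    large components would form a direction, that is, the neighbourhoods of an
    end; but one of these lies in a single member of the cover. *)
Lemma uncovered_splitting (U : set (set (end_space G))) : catching G ->
  open_cover U ->
  (forall W, W `<=` U -> countable W -> \bigcup_(A in W) A <> setT) ->
  exists big, [/\ persistent G big, splitting G big & exists x, big set0 x].
Proof.
move=> hG [[U0 UU0] oU UT] nU.
pose small (S : set (end_space G)) := exists W, [/\ W `<=` U, countable W &
  S `<=` \bigcup_(A in W) A].
have smallS S S' : S `<=` S' -> small S' -> small S.
  by move=> SS' [W [WU cW S'W]]; exists W; split=> //; exact: subset_trans S'W.
have small0 : small set0.
  by exists set0; split=> //; exact: countable0.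
have small_bigcup (S : nat -> set (end_space G)) : (forall n, small (S n)) ->
    small (\bigcup_n S n).
  move=> /choice[W hW]; exists (\bigcup_n W n); split.
  - by move=> A [n _ WA]; have [WU _ _] := hW n; exact: WU.
  - by apply: bigcup_countable => [|n _]; [exact: card_lexx|have [] := hW n].
  - move=> e [n _ Se]; have [_ _ /(_ e Se)[A WA Ae]] := hW n.
    by exists A => //; exists n.
pose big F x := (gverts G x /\ ~ F x) /\ ~ small (ends_at F x).
have hbig : persistent G big.
  split; first by move=> F x _ [].
    move=> F x y finF [Gx nx] xy; split; first exact: conn_gminus_vert Gx.
    by rewrite -(ends_at_conn xy).
  move=> F F' x finF finF' FF' [Gx nx]; apply: contrapT => h; apply: nx.
  have [P [hP PT]] := catching_ends (F := fun=> F') hG (fun=> finF')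
    (fun n => @subset_refl _ F').
  suff hs n : small (ends_at F x `&` P n).
    apply: smallS (small_bigcup _ hs) => e xe.
    by have [n _ Pe] : (\bigcup_n P n) e by [rewrite PT]; exists n.
  case: (hP n) => [->|[y ->]]; first by rewrite setI0.
  apply: (@contrapT (small _)) => ns.
  have [e [xe ye]] : exists e, ends_at F x e /\ ends_at F' y e.
    apply: contrapT => h'; apply: ns; apply: smallS small0 => e [xe ye].
    by apply: h'; exists e.
  have [z [Gz F'z ze]] := ends_at_exists e finF'.
  apply: h; exists z.
    exact: ends_at_uniq finF xe (ends_at_sub FF' ze).
  split=> // sz; apply: ns; apply: smallS sz.
  by rewrite (ends_at_conn (ends_at_uniq finF' ye ze)) => e' [].
exists big; split=> //.
- move=> F0 x0 finF0 big0; apply: contrapT => nsplit.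
  have [|r hr hD] := direction_ray hbig finF0 big0.
    move=> F y z finF FF xy xz Fy Fz; apply: contrapT => nyz.
    by apply: nsplit; exists F, y, z; split.
  have [e er] := ray_end hr.
  have [A UA Ae] : (\bigcup_(A in U) A) e by rewrite UT.
  have [F1 [x [finF1 xe FA]]] := (openP A).1 (oU A UA) e Ae.
  have finF : finite_set (F0 `|` F1) by rewrite finite_setU.
  have F1F : F1 `<=` F0 `|` F1 by right.
  have F0F : F0 `<=` F0 `|` F1 by left.
  have [n hn] := hD _ finF F0F.
  have [m hm] := ray_eventually hr finF.
  have [_ [_]] := hn (n + m) (leq_addr _ _); apply.
  exists [set A]; split.
  + by move=> _ ->.
  + exact: countable1.
  + rewrite bigcup_set1; apply: subset_trans FA.
    have re : ends_at (F0 `|` F1) (r (n + m)) e.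
      exists r => //; exists m => i mi.
      by have [] := hm (n + m) i (leq_addl _ _) mi.
    have xr := ends_at_uniq finF1 xe (ends_at_sub F1F re).
    by rewrite (ends_at_conn xr); exact: ends_at_sub.
- apply: contrapT => h.
  suff sT : small [set: end_space G].
    by have [W [WU cW WT]] := sT; apply: (nU W) => //; apply/seteqP; split.
  have [P [hP PT]] := catching_ends (F := fun=> set0) hG (fun=> finite_set0 V)
    (fun n => @subset_refl _ set0).
  rewrite -PT; apply: small_bigcup => n.
  case: (hP n) => [->//|[y ->]]; apply: contrapT => ns.
  have [e ye] : exists e : end_space G, ends_at set0 y e.
    apply: contrapT => h'; apply: ns; apply: smallS small0 => e ye.
    by apply: h'; exists e.
  have [z [Gz nz ze]] := ends_at_exists e (finite_set0 V).
  apply: h; exists z; split=> //.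
  by rewrite -(ends_at_conn (ends_at_uniq (finite_set0 V) ye ze)).
Qed.

End Sources.

(** * Subdivided binary trees *)

(** A subdivided binary tree with each edge oriented towards the child: [f] gives
    the branch vertices, and [E s c], of length [L s c], replaces the edge from [s]
    to [rcons s c]. *)
Record tree_in (V : Type) (K : graph V) (f : seq bool -> V)
    (L : seq bool -> bool -> nat) (E : seq bool -> bool -> nat -> V) : Prop :=
  TreeIn {
    tree_inj : injective f;
    tree_path : forall s c, gpath K (E s c) (L s c) (f s) (f (rcons s c));
    tree_node : forall s c i w, 0 < i < L s c -> E s c i <> f w;
    tree_edge : forall s c s' c' i j, 0 < i < L s c -> 0 < j < L s' c' ->
      E s c i = E s' c' j -> s = s' /\ c = c' }.

Definition tree_spans (V : Type) (H : graph V)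
    (L : seq bool -> bool -> nat) (E : seq bool -> bool -> nat -> V) :=
  (forall x, gverts H x -> exists s c i, i <= L s c /\ x = E s c i) /\
  (forall x y, gadj H x y -> exists s c i, i < L s c /\
     (x = E s c i /\ y = E s c i.+1 \/ y = E s c i /\ x = E s c i.+1)).

Lemma subdivision_tree (V : Type) (H : graph V) : subdivision binary_tree H ->
  exists f L E, tree_in H f L E /\ tree_spans H L E.
Proof.
move=> [f [l [P [f_inj Ppath [Pnode Pedge] Hv Ha]]]].
have adj s c : gadj binary_tree s (rcons s c) by exists c; left.
exists f, (fun s c => l s (rcons s c)), (fun s c => P s (rcons s c)); split.
  split=> [s t|s c|s c i w|s c s' c' i j].
  - by apply: f_inj; rewrite inE.
  - by have [] := Ppath _ _ (adj s c).
  - by move=> hi; exact: Pnode (adj s c) hi I.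
  - move=> hi hj /(Pedge _ _ _ _ _ _ (adj s c) (adj s' c') hi hj).
    case=> [[-> /rcons_inj[->]]//|[es es']]; exfalso.
    have := congr1 size es; have := congr1 size es'; rewrite !size_rcons; lia.
split=> [x|x y].
  move=> /(Hv x)[[w _ ->]|[u [v [i [[c [->|->]] il ->]]]]].
  - exists w, true, 0; split=> //.
    by have [[-> _ _ _]] := Ppath _ _ (adj w true).
  - by exists u, c, i.
  - exists v, c, (l v (rcons v c) - i); rewrite leq_subr; split=> //.
    have [_ _ e] := Ppath _ _ (adj v c); rewrite e //.
    by have [_ <-] := Ppath _ _ (adj v c).
move=> /(Ha x y)[u [v [i [[c [->|->]] il -> ->]]]].
  by exists u, c, i; split=> //; left.
have [_ el e] := Ppath _ _ (adj v c); rewrite el in il.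
exists v, c, (l v (rcons v c) - i.+1); split; first by lia.
right; rewrite -e // subnSK // -e //; exact: ltnW.
Qed.

(** Conversely the paths form a subdivision; the edge from a child to its parent
    carries the reversed path. *)
Lemma tree_subdivision (V : Type) (G : graph V) f L E : tree_in G f L E ->
  exists H, [/\ subgraph H G, subdivision binary_tree H,
                tree_in H f L E & tree_spans H L E].
Proof.
move=> hT; have [f_inj hE hnode hedge] := hT.
pose vs : set V := [set x | exists s c i, i <= L s c /\ x = E s c i].
pose ad x y := exists s c i, i < L s c /\
     (x = E s c i /\ y = E s c i.+1 \/ y = E s c i /\ x = E s c i.+1).
have ad_sym x y : ad x y -> ad y x.
  by move=> [s [c [i [il h]]]]; exists s, c, i; split=> //; case: h; [right|left].
have adG x y : ad x y -> gadj G x y.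
  move=> [s [c [i [il h]]]]; have [_ _ _ /(_ i il) a] := hE s c.
  by case: h => -[-> ->] //; exact: gadj_sym.
have ad_irr x : ~ ad x x by move=> /adG; exact: gadj_irr.
have ad_vs x y : ad x y -> vs x.
  move=> [s [c [i [il [[-> _]|[_ ->]]]]]]; exists s, c; last by exists i.+1.
  by exists i; split=> //; exact: ltnW.
pose H := Graph ad_sym ad_irr ad_vs.
have HG : subgraph H G.
  split=> [x [s [c [i [il ->]]]]|x y]; last exact: adG.
  have Gs : gverts G (f s).
    have [p0 pn _ pa] := hE s c; case: (posnP (L s c)) => [l0|l0].
      have := congr1 size (f_inj _ _ (etrans (esym p0) _ : f s = f (rcons s c))).
      by rewrite -l0 pn size_rcons => /(_ erefl); lia.
    by rewrite -p0; exact: gadj_verts (pa 0 l0).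
  exact: gpath_verts (hE s c) Gs il.
have hE' s c : gpath H (E s c) (L s c) (f s) (f (rcons s c)).
  by have [p0 pn pi pa] := hE s c; split=> // i il; exists s, c, i; split=> //; left.
have hTH : tree_in H f L E by split.
exists H; split=> //.
pose chd (u v : seq bool) := v == rcons u (last true v).
have chd_rcons u c : chd u (rcons u c) by rewrite /chd last_rcons.
have nchd u c : chd (rcons u c) u = false.
  by apply/eqP => /(congr1 size); rewrite !size_rcons; lia.
pose l (u v : seq bool) := if chd u v then L u (last true v) else L v (last true u).
pose P (u v : seq bool) i := if chd u v then E u (last true v) i
  else E v (last true u) (L v (last true u) - i).
have lD u c : l u (rcons u c) = L u c by rewrite /l chd_rcons last_rcons.
have lU u c : l (rcons u c) u = L u c by rewrite /l nchd last_rcons.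
have PD u c i : P u (rcons u c) i = E u c i by rewrite /P chd_rcons last_rcons.
have PU u c i : P (rcons u c) u i = E u c (L u c - i).
  by rewrite /P nchd last_rcons.
have PDf u c : P u (rcons u c) = E u c by apply/funext => i; exact: PD.
have PUf u c : P (rcons u c) u = fun i => E u c (L u c - i).
  by apply/funext => i; exact: PU.
exists f, l, P; split.
- by move=> s t _ _; exact: f_inj.
- move=> u v [c [->|->]].
    rewrite lD lU PDf PUf; split=> // i il; exact: hE'.
  rewrite lD lU PDf PUf; split=> // [|i il]; first exact: gpath_rev.
  by rewrite subKn.
- split.
    move=> u v w i [c [->|->]]; rewrite ?lD ?lU ?PD ?PU => hi _; apply: hnode; lia.
  move=> u v u' v' i j [c [->|->]] [c' [->|->]];
    rewrite ?lD ?lU ?PD ?PU => hi hj e.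
  + by have [-> ->] : _ /\ _ := hedge _ _ _ _ _ _ hi hj e; left.
  + have [] := hedge _ _ _ _ _ _ hi _ e; first by lia.
    by move=> -> ->; right.
  + have [] := hedge _ _ _ _ _ _ _ hj e; first by lia.
    by move=> -> ->; right.
  + have [] := hedge _ _ _ _ _ _ _ _ e; [lia|lia|].
    by move=> -> ->; left.
- move=> x; split=> [[s [c [i [il ->]]]]|].
    by right; exists s, (rcons s c), i; rewrite lD PD; split=> //; exists c; left.
  case=> [[w _ ->]|[u [v [i [[c [->|->]]]]]]].
  + by have [<- _ _ _] := hE w true; exists w, true, 0.
  + by rewrite lD PD => il ->; exists u, c, i.
  + by rewrite lU PU => il ->; exists v, c, (L v c - i); rewrite leq_subr.
- move=> x y; split=> [[s [c [i [il [[-> ->]|[-> ->]]]]]]|].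
  + exists s, (rcons s c), i; rewrite lD !PD; split=> //; by exists c; left.
  + exists (rcons s c), s, (L s c - i.+1); rewrite lU !PU; split.
    * by exists c; right.
    * by lia.
    * by congr E; lia.
    * by congr E; lia.
  + move=> [u [v [i [[c [->|->]]]]]]; rewrite ?lD ?lU ?PD ?PU => il -> ->.
      by exists u, c, i; split=> //; left.
    exists v, c, (L v c - i.+1); split; first by lia.
    by right; split=> //; congr E; lia.
Qed.

Lemma nodes_apart (s t : seq bool) : s <> t ->
  (exists c, prefix (rcons s c) t) \/ (exists c, prefix (rcons t c) s) \/
  exists u c, prefix (rcons u c) s /\ prefix (rcons u (~~ c)) t.
Proof.
elim: s t => [|a s IH] [|b t] // ne.
- by left; exists b; rewrite /= eqxx prefix0s.
- by right; left; exists a; rewrite /= eqxx prefix0s.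
have [eab|nab] := eqVneq a b; last first.
  right; right; exists [::], a; rewrite /= !prefix0s eqxx andbT; split=> //.
  by case: a b nab {ne} => -[].
have [|[c sc]|[[c tc]|[u [c [us ut]]]]] := IH t.
- by move=> e; apply: ne; rewrite eab e.
- by left; exists c; rewrite /= eab eqxx.
- by right; left; exists c; rewrite /= eab eqxx.
- by right; right; exists (a :: u), c; rewrite /= -eab !eqxx.
Qed.

Section Tree.
Context {V : Type} (H : graph V).
Variables (f : seq bool -> V) (L : seq bool -> bool -> nat).
Variable E : seq bool -> bool -> nat -> V.
Hypothesis hT : tree_in H f L E.
Implicit Types (s t u w : seq bool) (c : bool) (x y : V) (F : set V).

(** Apart from the root, every vertex of the tree lies on exactly one path [E s c]
    from which the initial vertex has been removed, and its home is the lower end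
    [rcons s c]. So [cone (rcons s c)] contains the interior of the path that leads
    to it, and the single vertex [f s] separates it from the rest of the tree. *)
Definition home x w := x = f w \/
  exists s c i, [/\ w = rcons s c, 0 < i < L s c & x = E s c i].

Definition cone s : set V := [set x | exists2 w, prefix s w & home x w].

Lemma home_edge s c i : 0 < i <= L s c -> home (E s c i) (rcons s c).
Proof.
move=> /andP[i0]; rewrite leq_eqVlt => /orP[/eqP->|il].
  by left; have [] := tree_path hT s c.
by right; exists s, c, i; rewrite i0.
Qed.

Lemma home_uniq x w w' : home x w -> home x w' -> w = w'.
Proof.
move=> [->|[s [c [i [-> hi ->]]]]] [|[s' [c' [j [-> hj]]]]].
- exact: (tree_inj hT).
- by move=> e; case: (tree_node hT hj (esym e)).
- by move=> e; case: (tree_node hT hi e).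
- by move=> /(tree_edge hT hi hj)[-> ->].
Qed.

Lemma prefix_comparable s t w : prefix s w -> prefix t w -> size s <= size t ->
  prefix s t.
Proof.
move=> /prefixP[u ->]; rewrite !prefixE => /eqP et st.
by rewrite -{1}et take_takel // take_size_cat.
Qed.

Lemma prefix_rconsP s w : prefix s w -> w = s \/ exists c, prefix (rcons s c) w.
Proof.
move=> /prefixP[[|c t] ->]; first by left; rewrite cats0.
by right; exists c; apply/prefixP; exists t; rewrite cat_rcons.
Qed.

Lemma cone_node s w : prefix s w -> cone s (f w).
Proof. by move=> sw; exists w => //; left. Qed.

Lemma coneS s t : prefix s t -> cone t `<=` cone s.
Proof. by move=> st x [w tw xw]; exists w => //; exact: prefix_trans tw. Qed.

Lemma cone_comparable s t x : cone s x -> cone t x -> size s <= size t ->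
  prefix s t.
Proof.
move=> [w sw xw] [w' tw' xw']; rewrite (home_uniq xw' xw) in tw'.
exact: prefix_comparable sw tw'.
Qed.

Lemma gpath_induced (K : graph V) (A : set V) p n x y : gpath K p n x y ->
  (forall i, i <= n -> A (p i)) -> gpath (induced K A) p n x y.
Proof.
move=> [p0 pn pi pa] Ap; split=> // i i_n; split; first exact: pa.
  by apply: Ap; exact: ltnW.
exact: Ap.
Qed.

Lemma cone_conn_node s t : conn (induced H (cone s)) (f s) (f (s ++ t)).
Proof.
elim/last_ind: t => [|t c IH]; first by rewrite cats0; exact: conn_refl.
apply: conn_trans IH _; rewrite -rcons_cat.
exists (L (s ++ t) c), (E (s ++ t) c); apply: gpath_induced.
  exact: (tree_path hT).
case=> [_|i il]; first by have [-> _ _ _] := tree_path hT (s ++ t) c;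
  apply: cone_node; exact: prefix_prefix.
exists (rcons (s ++ t) c); last by apply: home_edge; rewrite il.
by rewrite rcons_cat prefix_prefix.
Qed.

Lemma cone_conn s x y : cone s x -> cone s y -> conn (induced H (cone s)) x y.
Proof.
suff h z : cone s z -> conn (induced H (cone s)) (f s) z.
  by move=> /h sx /h; apply: conn_trans; exact: conn_sym.
move=> [w sw zw]; have /prefixP[t ew] := sw.
apply: conn_trans (cone_conn_node s t) _; rewrite -ew.
case: zw => [->|[u [c [i [ew' hi ->]]]]]; first exact: conn_refl.
apply: conn_sym; exists (L u c - i), (fun k => E u c (i + k)).
apply: gpath_induced.
  by rewrite ew'; apply: gpath_drop; [lia|exact: (tree_path hT)].
move=> k hk; exists w => //; rewrite ew'; apply: home_edge; lia.
Qed.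

Lemma finite_home w : finite_set [set x | home x w].
Proof.
case: (lastP w) => [|s c].
  apply: sub_finite_set (finite_set1 (f [::])) => x [//|[s [c [i [e _ _]]]]].
  by move: e => /(congr1 size); rewrite size_rcons.
apply: sub_finite_set (finite_image (E s c) (finite_II (L s c).+1)) => x.
case=> [->|[s' [c' [i [e hi ->]]]]].
  by exists (L s c); [rewrite /= ltnS|have [] := tree_path hT s c].
have [-> ->] := rcons_inj e; exists i => //=; lia.
Qed.

Lemma cone_exit x : exists n, forall s, n <= size s -> ~ cone s x.
Proof.
have [[w xw]|nx] := pselect (exists w, home x w); last first.
  by exists 0 => s _ [w _ xw]; apply: nx; exists w.
exists (size w).+1 => s sw [w' /size_prefix sw' xw'].
by rewrite (home_uniq xw xw') in sw; have := leq_trans sw sw'; rewrite ltnn.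
Qed.

Lemma cone_exit_finite F : finite_set F ->
  exists n, forall s x, n <= size s -> F x -> ~ cone s x.
Proof.
move=> finF; have /choice[n hn] := cone_exit.
have [N hN] := finite_bounded n finF; exists N => s x sN /hN xN.
by apply: hn; exact: leq_trans sN.
Qed.

Lemma branch_ray (b : nat -> bool) : exists2 r, is_ray H r &
  forall n, exists m, forall i, m <= i -> cone (mkseq b n) (r i).
Proof.
apply: (@nested_ray V H (fun n => cone (mkseq b n))) => [n|n|n x y|x].
- by apply: coneS; rewrite mkseqS; exact: prefix_rcons.
- by exists (f (mkseq b n)); apply: cone_node; exact: prefix_refl.
- exact: cone_conn.
- have [n hn] := cone_exit x; exists n; apply: hn; by rewrite size_mkseq.
Qed.

Hypothesis hS : tree_spans H L E.

Lemma home_exists x : gverts H x -> exists w, home x w.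
Proof.
move=> /(proj1 hS)[s [c [[|i] [il ->]]]]; last first.
  by exists (rcons s c); exact: home_edge.
by exists s; left; have [] := tree_path hT s c.
Qed.

(** An edge can leave a cone only through the branch vertex just above it. *)
Lemma cone_adj s x y : cone s x -> gadj H x y ->
  cone s y \/ exists u c, s = rcons u c /\ y = f u.
Proof.
move=> [w sw xw] /(proj2 hS)[u [c [i [il h]]]].
have h1 : home (E u c i.+1) (rcons u c) by exact: home_edge.
have [i0|i0] := posnP i; last first.
  have h0 : home (E u c i) (rcons u c) by apply: home_edge; rewrite i0 ltnW.
  left; exists (rcons u c); last by case: h => [[_ ->]|[-> _]].
  suff <- : w = rcons u c by [].
  by apply: home_uniq xw _; case: h => [[-> _]|[_ ->]].
(* the parent's end of the path is the only vertex with another home *)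
rewrite {}i0 in il h h1; have E0 : E u c 0 = f u by have [] := tree_path hT u c.
rewrite E0 in h; case: h => [[ex ->]|[-> ex]].
  left; exists (rcons u c) => //; have -> : u = w.
    by apply: home_uniq _ xw; left.
  exact: prefix_trans sw (prefix_rcons _ _).
have ew : w = rcons u c by apply: home_uniq xw _; rewrite ex.
have [su|nsu] := boolP (prefix s u); first by left; exact: cone_node.
right; exists u, c; split=> //; move: sw; rewrite ew => /prefixP[t].
case: (lastP t) => [|t' d]; first by rewrite cats0.
rewrite -rcons_cat => /rcons_inj[eu _].
by case/negP: nsu; rewrite eu prefix_prefix.
Qed.

Lemma cone_separated u c c' x y : c <> c' -> cone (rcons u c) x ->
  cone (rcons u c') y -> ~ conn (gminus H [set f u]) x y.
Proof.
move=> cc' ux uy xy; have : cone (rcons u c) y.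
  apply: conn_closed ux _ xy => a b ua [ab _ /= nb].
  case: (cone_adj ua ab) => // -[u' [d [/rcons_inj[<- _]]]] bu.
  by case: nb.
move=> /cone_comparable-/(_ _ uy); rewrite !size_rcons => /(_ (leqnn _)).
rewrite prefixE size_rcons -(size_rcons u c') take_size.
by move=> /eqP/rcons_inj[/esym/cc'].
Qed.

(** A ray of the tree leaves the finitely many vertices with home [s], and after
    leaving [f s] it stays below one child of [s]. *)
Lemma ray_in_cone r n : is_ray H r ->
  exists2 s, size s = n & exists m, forall i, m <= i -> cone s (r i).
Proof.
move=> hr; elim: n => [|n [s <- [m hm]]].
  exists [::] => //; exists 0 => i _.
  have [w rw] := home_exists (is_ray_verts i hr); exists w => //.
  exact: prefix0s.
have finF : finite_set ([set x | home x s] `|` [set f s]).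
  by rewrite finite_setU; split; [exact: finite_home|exact: finite_set1].
have [k hk] := ray_eventually hr finF.
have nF i : k <= i -> ~ home (r i) s /\ r i <> f s.
  by move=> ki; have [nFi _] := hk i i ki ki; split=> h; apply: nFi; [left|right].
have [w sw rw] := hm (m + k) (leq_addr _ _).
case: (prefix_rconsP sw) => [ew|[c scw]].
  by have [] := nF (m + k) (leq_addl _ _); rewrite -ew.
exists (rcons s c); first by rewrite size_rcons.
exists (m + k) => i /subnKC <-; elim: (i - _) => [|j IH].
  by rewrite addn0; exists w.
have [_ /(_ (m + k + j)) adj] := hr; rewrite addnS.
case: (cone_adj IH adj) => // -[u [d [/rcons_inj[<- _] e]]].
by have [] := nF (m + k + j).+1 _; first by lia.
Qed.

Lemma mkseq_fork (a b : nat -> bool) : a <> b -> exists n,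
  mkseq a n = mkseq b n /\ a n <> b n.
Proof.
move=> ab; have exn : exists n, a n != b n.
  apply: contrapT => h; apply: ab; apply/funext => n; apply: contrapT => /eqP nab.
  by apply: h; exists n.
case: (ex_minnP exn) => n /eqP nab minn; exists n; split=> //.
apply/eq_in_map => i; rewrite mem_iota add0n => /andP[_ i_n].
apply/eqP; apply: contraTT i_n => /minn; by rewrite -leqNgt.
Qed.

Lemma size_fork s t : size s = size t -> s <> t -> exists u c,
  prefix (rcons u c) s /\ prefix (rcons u (~~ c)) t.
Proof.
move=> st /nodes_apart[[c /size_prefix]|[[c /size_prefix]|//]];
  by rewrite size_rcons st ltnn.
Qed.

(** Rays of the tree that have tails in the same cones are equivalent in the tree,
    since a finite set misses all deep cones; the others are separated in [G] by
    assumption. *)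
Lemma tree_end_faithful (G : graph V) : subgraph H G ->
  (forall u, exists F n, finite_set F /\ forall t t' x y,
     prefix (rcons u false) t -> prefix (rcons u true) t' ->
     n <= size t -> n <= size t' -> cone t x -> cone t' y ->
     ~ conn (gminus G F) x y) ->
  end_faithful H G.
Proof.
move=> HG sep; split=> // r r' hr hr'; split; first exact: ray_equiv_sub.
move=> /(ray_equivP (is_ray_sub HG hr) (is_ray_sub HG hr')) rr'.
have same n s s' : size s = n -> size s' = n ->
    (exists m, forall i, m <= i -> cone s (r i)) ->
    (exists m, forall i, m <= i -> cone s' (r' i)) -> s = s'.
  move=> sn s'n [m hm] [m' hm']; apply: contrapT => ss'.
  have [u [c [us us']]] := size_fork (etrans sn (esym s'n)) ss'.
  have [F [k [finF hF]]] := sep u; have [q hq] := rr' F finF.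
  have [t tk [a ha]] := ray_in_cone (n + k) hr.
  have [t' t'k [a' ha']] := ray_in_cone (n + k) hr'.
  have st : prefix s t.
    apply: (cone_comparable (hm (m + a) _) (ha (m + a) _)); lia.
  have st' : prefix s' t'.
    apply: (cone_comparable (hm' (m' + a') _) (ha' (m' + a') _)); lia.
  have ut := prefix_trans us st; have ut' := prefix_trans us' st'.
  have con i j : q <= i -> q <= j -> conn (gminus G F) (r i) (r' j) by exact: hq.
  case: c us us' ut ut' => /= _ _ ut ut'.
    apply: (hF t' t (r' (q + a')) (r (q + a)) ut' ut); [lia|lia| | |].
    - by apply: ha'; lia.
    - by apply: ha; lia.
    - by apply: conn_sym; apply: con; lia.
  apply: (hF t t' (r (q + a)) (r' (q + a')) ut ut'); [lia|lia| | |].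
  - by apply: ha; lia.
  - by apply: ha'; lia.
  - by apply: con; lia.
apply/ray_equivP => // F finF; have [n hn] := cone_exit_finite finF.
have [s sn [m hm]] := ray_in_cone n hr.
have [s' s'n [m' hm']] := ray_in_cone n hr'.
have es : s = s' by apply: same sn s'n _ _; [exists m|exists m'].
exists (m + m') => i j hi hj.
have : conn (induced H (cone s)) (r i) (r' j).
  by apply: cone_conn; [apply: hm|rewrite es; apply: hm']; lia.
apply: conn_sub; split=> [x [Hx sx]|x y [xy sx sy]]; split=> //.
- by move=> Fx; apply: hn sx; rewrite ?sn.
- by move=> Fx; apply: hn sx; rewrite ?sn.
- by move=> Fy; apply: hn sy; rewrite ?sn.
Qed.

(** Send a branch to the end in [G] of a ray along it: a finite set of vertices
    misses a cone on this branch, and cones are connected, so the map is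
    continuous; distinct branches are separated in the tree by one vertex, and
    faithfulness carries this to [G]. *)
Lemma tree_cantor (G : graph V) : end_faithful H G ->
  contains_copy (end_space G) cantor_space.
Proof.
move=> [HG faithful].
have /choice[r hr] (a : cantor_space) : exists r, is_ray H r /\
    forall n, exists m, forall i, m <= i -> cone (mkseq a n) (r i).
  by have [r hr ra] := branch_ray a; exists r.
have rG a : is_ray G (r a) by exact: is_ray_sub HG (hr a).1.
have /choice[e he] (a : cantor_space) : exists e : end_space G, sval e (r a).
  exact: ray_end.
apply: (@cantor_copy _ _ e) => [a b eab|a].
  apply: contrapT => /mkseq_fork[n [ab nab]].
  have : ray_equiv G (r a) (r b) by apply: end_equiv (he a) _; rewrite eab.
  move=> /(faithful _ _ (hr a).1 (hr b).1).
  move=> /(ray_equivP (hr a).1 (hr b).1)/(_ _ (finite_set1 (f (mkseq a n)))).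
  move=> [k hk]; have [m hm] := (hr a).2 n.+1; have [m' hm'] := (hr b).2 n.+1.
  rewrite mkseqS in hm; rewrite mkseqS -ab in hm'.
  apply: (cone_separated nab (hm (k + m) _) (hm' (k + m') _) (hk _ _ _ _)); lia.
move=> U; rewrite nbhsE => -[U' [oU' U'e] U'U].
have [F [x [finF xe FU]]] := (openP U').1 oU' _ U'e.
have [n hn] := cone_exit_finite finF.
have nbh k : nbhs a [set b : cantor_space | mkseq b k = mkseq a k].
  elim: k => [|k IH]; first exact: filterS (@filterT _ _ _).
  have nk : nbhs a [set b : cantor_space | b k = a k].
    apply: (@proj_continuous nat (fun=> bool) k a [set c | c = a k]).
    by apply: open_nbhs_nbhs; split=> //; exact: discrete_open.
  by apply: filterS (filterI IH nk) => b [/= eb ek]; rewrite !mkseqS eb ek.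
apply: filterS (nbh n) => b /= eb; apply: U'U; apply: FU.
exists (r b) => //.
have [k hk] := ends_at_ray finF xe (he a).
have [m hm] := (hr a).2 n; have [m' hm'] := (hr b).2 n.
exists m' => i mi; apply: conn_trans (hk (k + m) _) _; first by lia.
have : conn (induced H (cone (mkseq a n))) (r a (k + m)) (r b i).
  by apply: cone_conn; [apply: hm; lia|rewrite -eb; exact: hm'].
apply: conn_sub; split=> [y [Hy sy]|y z [yz sy sz]]; split.
- exact: HG.1.
- by move=> Fy; apply: hn sy; rewrite ?size_mkseq.
- exact: HG.2.
- by move=> Fy; apply: hn sy; rewrite ?size_mkseq.
- by move=> Fz; apply: hn sz; rewrite ?size_mkseq.
Qed.

End Tree.

(** * Splitting components carry a binary tree *)

Section Growing.
Context {V : Type} (G : graph V).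
Implicit Types (F S : set V) (x y z v b : V) (p q : nat -> V).

Lemma gpath_avoid K F S p n x y : gpath (gminus K F) p n x y ->
  (forall i, i <= n -> ~ S (p i)) -> gpath (gminus K (F `|` S)) p n x y.
Proof.
move=> [p0 pn pi pa] nS; split=> // i i_n; have [a nF nF'] := pa i i_n.
split=> // -[] //; first exact: nS (ltnW i_n).
exact: nS i_n.
Qed.

Lemma conn_avoid K F S x y : conn (gminus K F) x y ->
  (forall z, conn (gminus K F) x z -> ~ S z) -> conn (gminus K (F `|` S)) x y.
Proof.
move=> [n [p xy]] nS; exists n, p; apply: gpath_avoid (xy) _ => i i_n.
by apply: nS; exists i, p; exact: gpath_take xy.
Qed.

Lemma gpath_cat (K : graph V) p n q m x y z :
  gpath K p n x y -> gpath K q m y z ->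
  (forall i j, i < n -> j <= m -> p i <> q j) ->
  gpath K (fun i => if i < n then p i else q (i - n)) (n + m) x z.
Proof.
move=> [p0 pn pi pa] [q0 qm qi qa] pq; split.
- by case: posnP => [n0|//]; rewrite sub0n q0 -pn n0.
- by rewrite ltnNge leq_addr /= addKn.
- move=> i j hi hj; case: ltnP => ni; case: ltnP => nj.
  + by apply: pi; exact: ltnW.
  + by move=> /pq; case=> //; lia.
  + by move=> /esym/pq; case=> //; lia.
  + move=> /qi e; have := e _ _; lia.
- move=> i hi; case: (ltnP i n) => ni; case: (ltnP i.+1 n) => ni1.
  + exact: pa.
  + have -> : i.+1 - n = 0 by lia.
    have en : n = i.+1 by lia.
    by rewrite q0 -pn [in p n]en; exact: pa.
  + lia.
  + by rewrite subSn //; apply: qa; lia.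
Qed.

Variable big : set V -> V -> Prop.
Hypothesis hbig : persistent G big.

Lemma big_conn_avoid F x y : finite_set F -> big F x ->
  conn (gminus G F) x y -> ~ F y.
Proof.
by move=> finF Fx xy; have [] := conn_gminus_vert xy (big_vert hbig finF Fx).
Qed.

(** The component of [x] is not affected by the new vertices, so that refining
    leads back into it. *)
Lemma big_avoid F F' x : finite_set F -> finite_set F' -> F `<=` F' ->
  big F x -> (forall z, conn (gminus G F) x z -> ~ F' z) -> big F' x.
Proof.
move=> finF finF' FF' Fx nF'; have [y xy F'y] := big_refine hbig finF finF' FF' Fx.
apply: (big_conn hbig finF' F'y); apply: conn_sym.
have := conn_avoid xy nF'; apply: conn_sub; apply: gminus_sub.
by move=> z; right.
Qed.

(** The cut contains the tripod except for the tips of its arms, so that a tripod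
    found later in the component of a tip is disjoint from this one. *)
Record tripod := Tripod {
  cut : set V; hub : V;
  stem_len : nat; stem : nat -> V;
  arm_len : bool -> nat; arm : bool -> nat -> V }.

Definition tip t c := arm t c (arm_len t c).

Record tripod_at F v t : Prop := TripodAt {
  cut_finite : finite_set (cut t);
  cut_sub : F `<=` cut t;
  stem_path : gpath (gminus G F) (stem t) (stem_len t) v (hub t);
  stem_cut : forall i, i <= stem_len t -> cut t (stem t i);
  arm_path : forall c, gpath (gminus G F) (arm t c) (arm_len t c) (hub t) (tip t c);
  arm_cut : forall c i, i < arm_len t c -> cut t (arm t c i);
  stem_arm : forall c i j, i <= stem_len t -> j <= arm_len t c ->
    stem t i = arm t c j -> j = 0;
  arm_arm : forall i j, i <= arm_len t false -> j <= arm_len t true ->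
    arm t false i = arm t true j -> i = 0 /\ j = 0;
  tip_big : forall c, big (cut t) (tip t c);
  tip_split : ~ conn (gminus G (cut t)) (tip t false) (tip t true) }.

(** The component of [y] can be entered last: what reaches the component of [z]
    may avoid it. So cut a path from [v] at its first vertex in the component of
    [y]; from its last vertex on this path, a path to a component that stays
    large gives the other arm. *)
Lemma tripod_aux F F2 v y z : finite_set F -> finite_set F2 -> F `<=` F2 ->
  big F v -> F2 v -> conn (gminus G F) v y -> big F2 y -> big F2 z ->
  ~ conn (gminus G F2) y z ->
  conn (gminus G (F `|` [set u | conn (gminus G F2) y u])) v z ->
  exists t, tripod_at F v t.
Proof.
move=> finF finF2 FF2 Fv F2v [n [q vy]] F2y F2z nyz vz.
set C := [set u | _] in vz.
have nCF2 u : C u -> ~ F2 u by exact: big_conn_avoid.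
have Cy : C y by exact: conn_refl.
have [m mn [Cm nCm]] := gpath_first_entry vy Cy.
have [q0 _ q_inj _] := vy.
have m_gt0 : 0 < m.
  by case: (posnP m) Cm => // ->; rewrite q0 => /nCF2.
pose T : set V := [set q i | i in `I_m].
pose F3 := F2 `|` T.
have finF3 : finite_set F3.
  by rewrite finite_setU; split=> //; apply: finite_image; exact: finite_II.
have F23 : F2 `<=` F3 by left.
have [z' zz' F3z'] := big_refine hbig finF2 finF3 F23 F2z.
pose C' : set V := [set u | conn (gminus G F3) z' u].
have nC'F3 u : C' u -> ~ F3 u by exact: big_conn_avoid.
have [Gv nFv] := big_vert hbig finF Fv.
have vz' : conn (gminus G (F `|` C)) v z'.
  apply: conn_trans vz _.
  have : conn (gminus G (F2 `|` C)) z z'.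
    apply: conn_avoid zz' _ => u zu yu; apply: nyz.
    by apply: conn_trans yu _; exact: conn_sym.
  by apply: conn_sub; apply: gminus_sub => u [/FF2|]; [left|right].
have [n' [q' pq']] := vz'.
have [q'0 q'n _ _] := pq'.
have vert_q' i : i <= n' -> ~ (F `|` C) (q' i).
  move=> i_n; have [] // : gverts (gminus G (F `|` C)) (q' i).
  apply: gpath_verts pq' _ i_n; split=> // -[//|/nCF2]; exact.
(* the last vertex of the path on T is the first one on its reverse *)
have Tv : T v by exists 0.
have [j jn' [Tj nTj]] := gpath_first_entry (gpath_rev pq') Tv.
have [k /= km qk] := Tj.
have := gpath_rev (gpath_take jn' (gpath_rev pq')).
set s := fun i => q' (n' - (j - i)); rewrite /= => ps.
have nTs i : 0 < i -> i <= j -> ~ T (s i).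
  by move=> i0 ij; apply: nTj; lia.
have nFCs i : i <= j -> ~ (F `|` C) (s i) by move=> ij; apply: vert_q'; lia.
have C'z' : C' z' by exact: conn_refl.
have [l lj [C'l nC'l]] := gpath_first_entry ps C'z'.
have [s0 _ _ _] := ps.
have l_gt0 : 0 < l.
  by case: (posnP l) C'l => // ->; rewrite s0 -qk => /nC'F3; case; right; exists k.
pose F4 := F3 `|` [set s i | i in `I_l].
have finF4 : finite_set F4.
  by rewrite finite_setU; split=> //; apply: finite_image; exact: finite_II.
have F34 : F3 `<=` F4 by left.
have F24 : F2 `<=` F4 by exact: subset_trans F34.
have Fs i : i < l -> F4 (s i) by move=> il; right; exists i.
have Fq i : i < m -> F4 (q i) by move=> im; left; right; exists i.
have qkE : q k = s 0 by rewrite s0 -qk.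
have bigm : big F4 (q m).
  apply: (@big_avoid F2) => //; first exact: (big_conn hbig finF2 F2y Cm).
  move=> u mu [[F2u|[i /= im qi]]|[i /= il si]].
  - by apply: nCF2 F2u; exact: conn_trans Cm mu.
  - by apply: nCm im _; rewrite qi; exact: conn_trans Cm mu.
  - apply: (nFCs i); first by lia.
    by right; rewrite si; exact: conn_trans Cm mu.
have bigl : big F4 (s l).
  apply: (@big_avoid F3) => //; first exact: (big_conn hbig finF3 F3z' C'l).
  move=> u lu [F3u|[i /= il si]].
  - by apply: nC'F3 F3u; exact: conn_trans C'l lu.
  - by apply: nC'l il _; rewrite si; exact: conn_trans C'l lu.
exists (Tripod F4 (q k) k q (fun c => if c then m - k else l)
         (fun c => if c then (fun i => q (k + i)) else s)).
have km' : k + (m - k) = m by lia.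
split; rewrite /tip /= ?km' //.
- exact: subset_trans F24.
- by apply: gpath_take vy; lia.
- by move=> i ik; apply: Fq; lia.
- case; rewrite ?km'.
    have := gpath_drop (ltnW km) (gpath_take mn vy); apply.
  have := gpath_take lj ps; rewrite -s0 -qkE.
  by apply: gpath_sub; apply: gminus_sub => u; left.
- by case=> i il; [apply: Fq; lia|exact: Fs].
- case=> i i' ik i'l.
    move=> /q_inj e; have := e _ _; lia.
  move=> e; case: (posnP i') => // i'0; case: (nTs i' i'0); first by lia.
  by rewrite -e; exists i => //=; lia.
- move=> i i' il i'm e.
  have [im|im] := ltnP (k + i') m.
    have i0 : i = 0.
      case: (posnP i) => // i0; case: (nTs i i0); first by lia.
      by rewrite e; exists (k + i').
    split=> //; move: e; rewrite i0 -qkE => /q_inj e; have := e _ _; lia.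
  have e' : k + i' = m by lia.
  by case: (nFCs i); [lia|right; rewrite e e'].
- by case; rewrite ?km'.
- move=> lm; apply: nyz; apply: conn_sym; apply: conn_trans zz' _.
  have C'l2 : conn (gminus G F2) z' (s l) by apply: conn_sub C'l; exact: gminus_sub.
  apply: conn_trans C'l2 _; apply: conn_trans _ (conn_sym Cm).
  by apply: conn_sub lm; exact: gminus_sub.
Qed.

Hypothesis hsplit : splitting G big.

(** Of the two components, a path from [v] enters one first, so avoiding
    the other. *)
Lemma tripod_exists F v : finite_set F -> big F v -> exists t, tripod_at F v t.
Proof.
move=> finF Fv.
have finF1 : finite_set (F `|` [set v]).
  by rewrite finite_setU; split=> //; exact: finite_set1.
have FF1 : F `<=` F `|` [set v] by left.
have [x vx F1x] := big_refine hbig finF finF1 FF1 Fv.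
have [F2 [y [z [finF2 F12 [xy xz] [F2y F2z] nyz]]]] := hsplit finF1 F1x.
have FF2 := subset_trans FF1 F12.
have F2v : F2 v by apply: F12; right.
have up u : conn (gminus G (F `|` [set v])) x u -> conn (gminus G F) v u.
  by move=> xu; apply: conn_trans vx _; apply: conn_sub xu; exact: gminus_sub.
pose C a : set V := [set u | conn (gminus G F2) a u].
have [n [q vy]] := up y xy.
have [m mn [Cm nCm]] : exists2 m, m <= n &
    (C y `|` C z) (q m) /\ forall i, i < m -> ~ (C y `|` C z) (q i).
  by apply: gpath_first_entry vy _; left; exact: conn_refl.
have reach a b : ~ conn (gminus G F2) a b -> C b (q m) ->
    (forall i, i < m -> ~ C a (q i)) -> conn (gminus G (F `|` C a)) v b.
  move=> nab bm nam.
  have disj u : C b u -> ~ C a u.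
    by move=> bu au; apply: nab; apply: conn_trans au (conn_sym bu).
  apply: (@conn_trans _ _ (q m)).
    exists m, q; apply: gpath_avoid; first exact: gpath_take mn vy.
    move=> i; rewrite leq_eqVlt => /orP[/eqP->|]; [exact: disj|exact: nam].
  apply: conn_sym; apply: conn_sub (conn_avoid bm disj); apply: gminus_sub => u.
  by move=> [/FF2|]; [left|right].
case: Cm => Cm.
  have zy : ~ conn (gminus G F2) z y by move=> zy; apply: nyz; exact: conn_sym.
  apply: (tripod_aux finF finF2 FF2 Fv F2v (up z xz) F2z F2y zy).
  by apply: reach => // i im Cq; apply: (nCm i im); right.
apply: (tripod_aux finF finF2 FF2 Fv F2v (up y xy) F2y F2z nyz).
by apply: reach => // i im Cq; apply: (nCm i im); left.
Qed.

Variable x0 : V.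
Hypothesis big0 : big set0 x0.

(** Nested components make the tripods at different nodes disjoint, and siblings
    are separated by the cut at their parent, which makes the tree end-faithful. *)
Lemma splitting_tree : exists H, end_faithful H G /\ subdivision binary_tree H.
Proof.
have /choice[tr htr] (Fv : set V * V) : exists t,
    finite_set Fv.1 -> big Fv.1 Fv.2 -> tripod_at Fv.1 Fv.2 t.
  have [[finF Fv2]|h] := pselect (finite_set Fv.1 /\ big Fv.1 Fv.2).
    by have [t ht] := tripod_exists finF Fv2; exists t.
  exists (Tripod set0 x0 0 (fun=> x0) (fun=> 0) (fun=> fun=> x0)) => finF Fv2.
  by case: h.
pose st := foldl (fun Fv c => (cut (tr Fv), tip (tr Fv) c)) (set0, x0).
pose tri s := tr (st s).
have stS s c : st (rcons s c) = (cut (tri s), tip (tri s) c).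
  by rewrite /st foldl_rcons.
have good s : finite_set (st s).1 /\ big (st s).1 (st s).2.
  elim/last_ind: s => [|s c [finF Fv]]; first by split=> //; exact: finite_set0.
  rewrite stS; have ht := htr _ finF Fv.
  by split; [exact: cut_finite ht|exact: tip_big ht c].
have ht s : tripod_at (st s).1 (st s).2 (tri s).
  by have [finF Fv] := good s; exact: htr.
(* reg s is the component entered at node s. The tripod at s without the ends
   of its arms lies in ann s, and these sets are pairwise disjoint. *)
pose reg s : set V := [set x | conn (gminus G (st s).1) (st s).2 x].
pose ann s : set V := [set x | reg s x /\ cut (tri s) x].
have regS s c : reg (rcons s c) `<=` reg s.
  move=> x; rewrite /reg /= stS /= => cx.
  have hs : conn (gminus G (st s).1) (st s).2 (hub (tri s)).
    by exists (stem_len (tri s)), (stem (tri s)); exact: stem_path (ht s).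
  apply: conn_trans hs _; apply: (@conn_trans _ _ (tip (tri s) c)).
    by exists (arm_len (tri s) c), (arm (tri s) c); exact: arm_path (ht s) c.
  by apply: conn_sub cx; apply: gminus_sub; exact: cut_sub (ht s).
have reg_prefix s t : prefix s t -> reg t `<=` reg s.
  move=> /prefixP[u ->]; elim/last_ind: u => [|u c IH]; first by rewrite cats0.
  rewrite -rcons_cat; exact: subset_trans (@regS _ _) IH.
have reg_cut s c x : reg (rcons s c) x -> ~ cut (tri s) x.
  have [finF Fv] := good (rcons s c) => /(big_conn_avoid finF Fv).
  by rewrite stS.
have reg_fork u c x y : reg (rcons u c) x -> reg (rcons u (~~ c)) y ->
    ~ conn (gminus G (cut (tri u))) x y.
  rewrite /reg /= !stS /= => cx cy xy.
  have h : conn (gminus G (cut (tri u))) (tip (tri u) c) (tip (tri u) (~~ c)).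
    by apply: conn_trans cx (conn_trans xy (conn_sym cy)).
  by apply: (tip_split (ht u)); case: c h {cx cy} => //=; exact: conn_sym.
have ann_uniq s t x : ann s x -> ann t x -> s = t.
  move=> [sx scx] [tx tcx]; apply: contrapT => /nodes_apart.
  move=> [[c sct]|[[c tcs]|[u [c [us ut]]]]].
  - exact: reg_cut (reg_prefix _ _ sct _ tx) scx.
  - exact: reg_cut (reg_prefix _ _ tcs _ sx) tcx.
  - apply: (reg_fork u c x x); [exact: reg_prefix us _ sx|exact: reg_prefix ut _ tx|].
    exact: conn_refl.
pose f s := hub (tri s).
pose la s c := arm_len (tri s) c; pose lp s := stem_len (tri s).
pose L s c := la s c + lp (rcons s c).
pose E s c i := if i < la s c then arm (tri s) c i
                else stem (tri (rcons s c)) (i - la s c).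
have stem_ann s i : i <= lp s -> ann s (stem (tri s) i).
  move=> il; split; last exact: stem_cut (ht s) i il.
  exists i, (stem (tri s)); exact: gpath_take il (stem_path (ht s)).
have stem_end s : stem (tri s) (lp s) = f s.
  by have [] := stem_path (ht s).
have hub_ann s : ann s (f s) by rewrite -stem_end; exact: stem_ann.
have arm_ann s c i : i < la s c -> ann s (arm (tri s) c i).
  move=> il; split; last exact: arm_cut (ht s) c i il.
  apply: conn_trans (hub_ann s).1 _.
  exists i, (arm (tri s) c); exact: gpath_take (ltnW il) (arm_path (ht s) c).
have arm0 s c : arm (tri s) c 0 = f s by have [] := arm_path (ht s) c.
have arm_hub s c i : i <= la s c -> arm (tri s) c i = f s -> i = 0.
  have [_ _ inj _] := arm_path (ht s) c; rewrite -(arm0 s c) => il; exact: inj.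
have stem_hub s i : i <= lp s -> stem (tri s) i = f s -> i = lp s.
  have [_ _ inj _] := stem_path (ht s); rewrite -(stem_end s) => il /inj; exact.
have E_ann s c i : i <= L s c ->
    ann (if i < la s c then s else rcons s c) (E s c i).
  rewrite /E /L => iL; case: ifP => [|/negbT]; first exact: arm_ann.
  by rewrite -leqNgt => li; apply: stem_ann; lia.
have hT : tree_in G f L E.
  split.
  - by move=> s t e; apply: (ann_uniq s t (f s)); rewrite ?e; [rewrite -e|].
  - move=> s c; apply: gpath_cat.
    + exact: gpath_sub (gminus_sub0 _ _) (arm_path (ht s) c).
    + have := stem_path (ht (rcons s c)); rewrite [in X in gpath _ _ _ X]stS /=.
      exact: gpath_sub (gminus_sub0 _ _).
    + move=> i j il jl e; have := stem_ann _ _ jl; rewrite -e.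
      by move=> h; case: (rcons_neq (ann_uniq _ _ _ (arm_ann _ _ _ il) h)).
  - move=> s c i w hi e; have iL : i <= L s c by lia.
    have := E_ann s c i iL; rewrite e => /ann_uniq-/(_ _ (hub_ann w)) ew.
    move: e ew; rewrite /E; case: ifP => il e ew; subst w.
      by have := arm_hub s c i (ltnW il) e; lia.
    by have := stem_hub (rcons s c) (i - la s c) _ e; rewrite /L in iL hi; lia.
  - move=> s c s' c' i j hi hj e.
    have iL : i <= L s c by lia.
    have jL : j <= L s' c' by lia.
    have := E_ann s c i iL; rewrite e => /ann_uniq-/(_ _ (E_ann s' c' j jL)).
    move: e; rewrite /E; case: ifP => /= il; case: ifP => /= jl.
    + move=> e es; subst s'; split=> //; apply: contrapT => cc'.
      have : i = 0 \/ j = 0; last by lia.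
      case: c c' cc' e {hi hj iL jL} il jl => -[] // _ e il jl.
        by right; have [] := arm_arm (ht s) (ltnW jl) (ltnW il) (esym e).
      by left; have [] := arm_arm (ht s) (ltnW il) (ltnW jl) e.
    + move=> e es; exfalso; rewrite -es in e.
      have jlp : j - la s' c' <= stem_len (tri s).
        by move: jL; rewrite /L /lp -es; lia.
      have := stem_arm (ht s) jlp (ltnW il) (esym e); lia.
    + move=> e es; exfalso; rewrite es in e.
      have ilp : i - la s c <= stem_len (tri s').
        by move: iL; rewrite /L /lp es; lia.
      have := stem_arm (ht s') ilp (ltnW jl) e; lia.
    + by move=> _ /rcons_inj[-> ->].
have [H [HG sub hTH hS]] := tree_subdivision hT.
exists H; split=> //; apply: (tree_end_faithful hTH hS HG) => u.
have cone_reg c t x : prefix (rcons u c) t -> (size u).+2 <= size t ->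
    cone f L E t x -> reg (rcons u c) x.
  move=> ut tu [w tw [->|[s [d [i [ew hi ->]]]]]].
    by apply: reg_prefix (hub_ann w).1; exact: prefix_trans tw.
  have us : prefix (rcons u c) s.
    apply: (@prefix_comparable _ _ w); first exact: prefix_trans tw.
      by rewrite ew; exact: prefix_rcons.
    by have := leq_trans tu (size_prefix tw); rewrite ew !size_rcons ltnS.
  have [r _] := E_ann s d i (ltnW (andP hi).2).
  apply: (reg_prefix _ _ us); case: ifP r => // _; exact: regS.
exists (cut (tri u)), (size u).+2; split; first exact: cut_finite (ht u).
move=> t t' x y ut ut' tn t'n tx t'y.
exact: (reg_fork u false) (cone_reg _ _ _ ut tn tx) (cone_reg _ _ _ ut' t'n t'y).
Qed.

End Growing.

(** * The equivalence *)

Section Equivalence.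
Context {V : Type} (G : graph V).

Lemma no_tree_scattered :
  ~ (exists H : graph V, end_faithful H G /\ subdivision binary_tree H) ->
  scattered (end_space G).
Proof.
move=> noH A A0; apply: contrapT => isoA; apply: noH.
have [|big [hbig hsplit [x big0]]] := crowded_splitting A0.
  by apply/seteqP; split=> // e Ae; apply: isoA; exists e.
exact: (splitting_tree hbig hsplit big0).
Qed.

Lemma tree_contains_cantor :
  (exists H : graph V, end_faithful H G /\ subdivision binary_tree H) ->
  contains_copy (end_space G) cantor_space.
Proof.
move=> [H [faithful /subdivision_tree[f [L [E [hT hS]]]]]].
exact: (tree_cantor hT hS faithful).
Qed.

(** Without a countable subcover there would be a copy of the Cantor space, which
    catching excludes. *)
Lemma catching_lindelof : catching G -> lindelof (end_space G).
Proof.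
move=> hG U cU; apply: contrapT => nW; apply: (catching_no_cantor hG).
apply: tree_contains_cantor.
have [|big [hbig hsplit [x big0]]] := uncovered_splitting hG cU.
  by move=> W WU cW WT; apply: nW; exists W.
exact: (splitting_tree hbig hsplit big0).
Qed.

End Equivalence.

Theorem corollary4p9 (V : Type) (G : graph V) :
  [<-> rothberger (end_space G);
       lindelof (end_space G) /\ ~ contains_copy (end_space G) cantor_space;
       lindelof (end_space G) /\ scattered (end_space G);
       lindelof (end_space G) /\
         ~ (exists H : graph V, end_faithful H G /\ subdivision binary_tree H);
       forall F : nat -> set V,
         (forall n, finite_verts G (F n)) -> (forall n, F n `<=` F n.+1) ->
         exists2 C : nat -> graph V,
           (forall n, component (gminus G (F n)) (C n)) &
           (forall r, is_ray G r -> exists n, has_tail_in r (C n)) ].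
Proof.
have ab : rothberger (end_space G) ->
    lindelof (end_space G) /\ ~ contains_copy (end_space G) cantor_space.
  move=> roth; split; first exact: rothberger_lindelof.
  by apply: catching_no_cantor; exact: rothberger_catching.
have bd : lindelof (end_space G) /\ ~ contains_copy (end_space G) cantor_space ->
    lindelof (end_space G) /\
    ~ (exists H : graph V, end_faithful H G /\ subdivision binary_tree H).
  by move=> [lin ncopy]; split=> // /tree_contains_cantor.
have da : lindelof (end_space G) /\
    ~ (exists H : graph V, end_faithful H G /\ subdivision binary_tree H) ->
    rothberger (end_space G).
  by move=> [lin /no_tree_scattered]; exact: end_space_rothberger.
tfae.
- exact: ab.
- by move=> /bd[lin /no_tree_scattered].
- by move=> [lin scat]; apply/bd/ab; exact: end_space_rothberger.
- by move=> /da; exact: rothberger_catching.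
- move=> hG; apply: da; apply: bd; split; first exact: catching_lindelof.
  exact: catching_no_cantor.
Qed.
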